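(* Let $X$ be an infinite-dimensional complex Banach space and let $T$ be a bounded linear operator on $X$. Then $T$ is right generalized Drazin invertible if and only if $T$ admits a generalized Kato decomposition $(M,N)$ and satisfies one of the following assertions, which are equivalent to each other for an operator $T$ with a generalized Kato decomposition $(M,N)$: (i) $T^*$ has the SVEP at $0$; (ii) $T_M$ is surjective; (iii) $K(T)=M$; (iv) $X=K(T)+H_0(T)$; (v) $K(T)+H_0(T)$ is norm dense in $X$.
   Context: $\mathcal{L}(X)$ is the algebra of bounded linear operators on $X$; $T_M$ denotes the restriction of $T$ to a $T$-invariant closed subspace $M$, regarded as an operator on $M$; $T^*$ is the adjoint acting on the dual space $X^*$. The quasinilpotent part of $T$ is $H_0(T)=\{x\in X:\lim_{n\to\infty}\|T^nx\|^{1/n}=0\}$. The analytical core $K(T)$ of $T$ is the set of all $x\in X$ for which there exist a sequence $(x_n)_{n\ge1}$ in $X$ and a constant $\delta>0$ such that $Tx_1=x$, $Tx_{n+1}=x_n$ and $\|x_n\|\le\delta^n\|x\|$ for all $n\in\mathbb{N}$. $T\in\mathcal{L}(X)$ is right generalized Drazin invertible if $K(T)$ is closed and there is a closed subspace $N$ of $X$ with $X=K(T)\oplus N$ and $T(N)\subset N\subseteq H_0(T)$. An operator $S$ is semi-regular if its range $R(S)$ is closed and $N(S^n)\subseteq R(S)$ for all $n\in\mathbb{N}$, where $N(\cdot)$ is the null space. A pair $(M,N)$ of closed subspaces is a generalized Kato decomposition (GKD) of $T$ if $X=M\oplus N$, $T(M)\subset M$, $T(N)\subset N$, $T_M$ is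 semi-regular and $T_N$ is quasinilpotent. An operator $S$ on a Banach space $Y$ has the single-valued extension property (SVEP) at $\lambda_0\in\mathbb{C}$ if for every connected open neighborhood $\mathcal{U}$ of $\lambda_0$ the only analytic function $f:\mathcal{U}\to Y$ satisfying $(\lambda I-S)f(\lambda)=0$ for all $\lambda\in\mathcal{U}$ is $f\equiv 0$. *)

(* Defs.v *)
From HB Require Import structures.
From mathcomp Require Import all_boot all_order all_algebra.
From mathcomp Require Import all_classical all_reals all_analysis.
From mathcomp Require Import complex.

Set Implicit Arguments.
Unset Strict Implicit.
Unset Printing Implicit Defensive.

Import Order.TTheory GRing.Theory Num.Theory.
Import numFieldNormedType.Exports.

Local Open Scope classical_set_scope.
Local Open Scope complex_scope.
Local Open Scope ring_scope.

(* In a [normedModType R[i]] the norm takes its values in [R[i]] (it is a      *)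
(* nonnegative, hence real, complex number); [nrm] is the same norm seen in R. *)
Section RealNorm.
Context {R : realType} {X : normedModType R[i]}.

Definition nrm (x : X) : R := complex.Re `|x|.

Lemma nrmE x : `|x| = (nrm x)%:C.
Proof.
have := normr_ge0 x; rewrite /nrm; case: `|x| => a b.
by rewrite lecE /= => /andP[/eqP-> _].
Qed.

Lemma nrm_ge0 x : 0 <= nrm x.
Proof. by rewrite -lecR -nrmE normr_ge0. Qed.

Lemma nrm0 : nrm 0 = 0.
Proof. by rewrite /nrm normr0. Qed.

Lemma nrm_eq0 x : nrm x = 0 -> x = 0.
Proof. by move=> x0; apply/normr0_eq0; rewrite nrmE x0. Qed.

Lemma nrmD x y : nrm (x + y) <= nrm x + nrm y.
Proof. by rewrite -lecR rmorphD /= -!nrmE ler_normD. Qed.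

Lemma nrmZ (k : R[i]) x : nrm (k *: x) = complex.Re `|k| * nrm x.
Proof.
rewrite /nrm normrZ (nrmE x) /=.
by case: `|k| => a b /=; rewrite mulr0 subr0.
Qed.

Lemma nrmN x : nrm (- x) = nrm x.
Proof. by rewrite /nrm normrN. Qed.

End RealNorm.


Lemma real_complex_gt0 (R : realType) (e : R[i]) :
  0 < e -> exists2 d : R, 0 < d & e = d%:C.
Proof. by case: e => d f; rewrite ltcE /= => /andP[/eqP-> d0]; exists d. Qed.

Lemma normc_ge_Im (R : realType) (z : R[i]) : `|complex.Im z|%:C <= `|z|.
Proof.
have := normc_ge_Re (z * 'i%C); rewrite ReiNIm normrN normrM.
have -> : `|'i%C : R[i]| = 1.
  by rewrite normc_def /= expr0n expr1n add0r sqrtr1.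
by rewrite mulr1.
Qed.

Lemma normc_le_ReIm (R : realType) (z : R[i]) :
  `|z| <= (`|complex.Re z| + `|complex.Im z|)%:C.
Proof.
rewrite normc_def lecR -(@ler_pXn2r _ 2) ?nnegrE ?addr_ge0//.
rewrite sqr_sqrtr ?addr_ge0 ?sqr_ge0// sqrrD !real_normK ?num_real//.
by rewrite addrAC lerDl mulrn_wge0 ?mulr_ge0.
Qed.

Lemma complex_complete (R : realType) (F : set_system R[i]^o) :
  ProperFilter F -> cauchy F -> cvg F.
Proof.
move=> FF /cauchyP Fc.
have cR (p : R[i]^o -> R) : (forall z w, `|p z - p w|%:C <= `|z - w|) ->
    cvg (p @ F).
  move=> pE; apply: R_complete; apply/cauchyP => e e0.
  have [|z Fz] := Fc e%:C; first by rewrite ltcR.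
  exists (p z); rewrite /fmap /=; near=> y => /=.
  rewrite -ball_normE /ball_ /= -ltcR (le_lt_trans (pE _ _))//.
  by near: y; move: Fz; rewrite -ball_normE.
have /cvg_ex[a /cvgrPdist_lt Fa] : cvg ((fun z : R[i]^o => complex.Re z) @ F).
  by apply: cR => z w; rewrite -raddfB normc_ge_Re.
have /cvg_ex[b /cvgrPdist_lt Fb] : cvg ((fun z : R[i]^o => complex.Im z) @ F).
  by apply: cR => z w; rewrite -raddfB normc_ge_Im.
apply/cvg_ex; exists (a +i* b : R[i]^o).
apply/cvgrPdist_lt => _ /real_complex_gt0[d d0 ->].
near=> z.
rewrite (le_lt_trans (normc_le_ReIm _))// ltcR (splitr d) ltrD//.
- have -> : complex.Re (a +i* b - z) = a - complex.Re z by rewrite raddfB.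
  by near: z; apply: Fa; rewrite divr_gt0.
- have -> : complex.Im (a +i* b - z) = b - complex.Im z by rewrite raddfB.
  by near: z; apply: Fb; rewrite divr_gt0.
Unshelve. all: by end_near. Qed.

Section BoundedOperators.
Context {R : realType} (X Y : normedModType R[i]).

Definition bounded_linear : {pred X -> Y} :=
  mem [set f : X -> Y | linear f /\
    exists M : R, forall x, nrm (f x) <= M * nrm x].

Record bop := Bop { bop_fun :> X -> Y ; _ : bop_fun \in bounded_linear }.

HB.instance Definition _ := [isSub for bop_fun].
HB.instance Definition _ := [Choice of bop by <:].

Lemma bounded_linearP (f : X -> Y) : linear f ->
  (exists M : R, forall x, nrm (f x) <= M * nrm x) -> f \in bounded_linear.
Proof. by move=> fl fb; apply/mem_set. Qed.

Lemma bop_linear (f : bop) : linear f.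
Proof. by have /set_mem[] := valP f. Qed.

Lemma bop_bounded (f : bop) : exists M : R, forall x, nrm (f x) <= M * nrm x.
Proof. by have /set_mem[] := valP f. Qed.

HB.instance Definition _ (f : bop) :=
  GRing.isLinear.Build R[i] X Y *:%R f (bop_linear f).

Lemma bounded_linear_submod_closed : submod_closed bounded_linear.
Proof.
split.
  apply: bounded_linearP => [k x y|]; first by rewrite scaler0 addr0.
  by exists 0 => x; rewrite mul0r nrm0.
move=> k f g /set_mem[fl [M fM]] /set_mem[gl [N gN]].
apply: bounded_linearP => [a x y|].
  by rewrite !fctE fl gl !scalerDr !scalerA mulrC addrACA.
exists (complex.Re `|k| * M + N) => x; rewrite !fctE.
rewrite (le_trans (nrmD _ _))// mulrDl lerD// nrmZ -mulrA ler_wpM2l//.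
exact: (@nrm_ge0 _ R[i]^o).
Qed.

HB.instance Definition _ :=
  GRing.isSubmodClosed.Build _ _ bounded_linear bounded_linear_submod_closed.
HB.instance Definition _ := [SubChoice_isSubLmodule of bop by <:].

(* The supremum is meaningful for bounded linear [f] only.                     *)
Definition opnorm (f : X -> Y) : R :=
  sup [set nrm (f x) | x in [set x | nrm x <= 1]].

Lemma opnorm_has_sup (f : bop) :
  has_sup [set nrm (f x) | x in [set x | nrm x <= 1]].
Proof.
split; first by exists (nrm (f 0)), 0 => //=; rewrite nrm0.
have [M fM] := bop_bounded f.
exists (Num.max 0 M) => _ [x /= x1 <-]; rewrite (le_trans (fM x))//.
rewrite (@le_trans _ _ (Num.max 0 M * nrm x))//.
  by rewrite ler_wpM2r ?nrm_ge0// le_max lexx orbT.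
by rewrite ler_piMr// le_max lexx.
Qed.

Lemma opnorm_ge0 (f : bop) : 0 <= opnorm f.
Proof.
apply: (@le_trans _ _ (nrm (f 0))); first exact: nrm_ge0.
by apply: ub_le_sup; [case: (opnorm_has_sup f)|exists 0 => //=; rewrite nrm0].
Qed.

Lemma nrm_le_opnorm (f : bop) x : nrm (f x) <= opnorm f * nrm x.
Proof.
have [x0|x0] := eqVneq (nrm x) 0.
  by rewrite (nrm_eq0 x0) linear0 !nrm0 mulr0.
have xp : 0 < nrm x by rewrite lt_neqAle eq_sym x0 nrm_ge0.
have vE : complex.Re `|((nrm x)^-1)%:C| = (nrm x)^-1.
  by rewrite ger0_norm// lecR invr_ge0 ltW.
rewrite -ler_pdivrMr// mulrC -vE -nrmZ -linearZ.
apply: ub_le_sup; first by case: (opnorm_has_sup f).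
by exists (((nrm x)^-1)%:C *: x) => //=; rewrite nrmZ vE mulVf.
Qed.

Lemma opnorm_le (f : bop) (M : R) : 0 <= M ->
  (forall x, nrm (f x) <= M * nrm x) -> opnorm f <= M.
Proof.
move=> M0 fM; apply: ge_sup; first by case: (opnorm_has_sup f).
by move=> _ [x /= x1 <-]; rewrite (le_trans (fM x))// ler_piMr.
Qed.

Lemma opnormD (f g : bop) : opnorm (f + g) <= opnorm f + opnorm g.
Proof.
apply: (@opnorm_le (f + g)) => [|x]; first by rewrite addr_ge0 ?opnorm_ge0.
by rewrite mulrDl (le_trans (nrmD _ _))// lerD ?nrm_le_opnorm.
Qed.

Lemma opnormZ (k : R[i]) (f : bop) :
  opnorm (k *: f) = complex.Re `|k| * opnorm f.
Proof.
have ge0 (l : R[i]) : 0 <= complex.Re `|l| by exact: (@nrm_ge0 _ R[i]^o).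
have le (l : R[i]) (g : bop) :
    opnorm (l *: g) <= complex.Re `|l| * opnorm g.
  apply: (@opnorm_le (l *: g)) => [|x]; first by rewrite mulr_ge0 ?opnorm_ge0.
  by rewrite -mulrA [X in X <= _]nrmZ ler_wpM2l// nrm_le_opnorm.
apply/eqP; rewrite eq_le le andTb.
have [->|k0] := eqVneq k 0; first by rewrite normr0 mul0r opnorm_ge0.
have kE : complex.Re `|k^-1| = (complex.Re `|k|)^-1.
  have := @nrmE _ R[i]^o k; rewrite /nrm normfV => ->.
  by rewrite -fmorphV.
have kp : 0 < complex.Re `|k|.
  rewrite lt_neqAle ge0 andbT eq_sym.
  by apply: contra_neq k0; exact: (@nrm_eq0 _ R[i]^o).
rewrite -ler_pdivlMl// -kE; apply: le_trans (le _ _).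
by rewrite scalerA mulVf// scale1r.
Qed.

Lemma opnorm_eq0 (f : bop) : opnorm f = 0 -> f = 0.
Proof.
move=> f0; apply/val_inj/funext => x; apply/nrm_eq0/eqP.
by rewrite eq_le nrm_ge0 andbT (le_trans (nrm_le_opnorm f x))// f0 mul0r.
Qed.

Lemma bop_normD (f g : bop) :
  (opnorm (f + g))%:C <= (opnorm f)%:C + (opnorm g)%:C.
Proof. by rewrite -rmorphD lecR opnormD. Qed.

Lemma bop_normZ (k : R[i]) (f : bop) :
  (opnorm (k *: f))%:C = `|k| * (opnorm f)%:C.
Proof. by rewrite opnormZ rmorphM (@nrmE _ R[i]^o k). Qed.

Lemma bop_norm_eq0 (f : bop) : (opnorm f)%:C = 0 -> f = 0.
Proof. by move=> f0; apply/opnorm_eq0/(@complexI R). Qed.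

HB.instance Definition _ := Lmodule_isNormed.Build R[i] bop
  bop_normD bop_normZ bop_norm_eq0.

End BoundedOperators.

Arguments bounded_linear {R X Y}.

Lemma bop_nrmE (R : realType) (X Y : normedModType R[i]) (f : bop X Y) :
  nrm f = opnorm f.
Proof. by []. Qed.

Lemma bop_complete (R : realType) (X Y : normedModType R[i]) :
  (forall G : set_system Y, ProperFilter G -> cauchy G -> cvg G) ->
  forall F : set_system (bop X Y), ProperFilter F -> cauchy F -> cvg F.
Proof.
move=> Yc F FF /cauchyP Fc.
have Fball (e : R) : 0 < e -> exists f : bop X Y, \forall g \near F, opnorm (f - g) <= e.
  move=> e0; have [|f Ff] := Fc e%:C; first by rewrite ltcR.
  exists f; move: Ff; rewrite -ball_normE; apply: filterS => g /=.
  by rewrite nrmE ltcR => /ltW.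
have Fpt x : cvg ((fun f : bop X Y => f x) @ F).
  apply: Yc; apply/cauchyP => _ /real_complex_gt0[d d0 ->].
  have xp : 0 < 1 + nrm x by rewrite ltr_wpDr ?nrm_ge0.
  have [f Ff] := Fball _ (divr_gt0 d0 xp).
  exists (f x); rewrite /fmap /=; near=> g => /=.
  rewrite -ball_normE /ball_ /= nrmE ltcR.
  apply: (@le_lt_trans _ _ (opnorm (f - g) * nrm x)).
    exact: (nrm_le_opnorm (f - g) x).
  apply: (@le_lt_trans _ _ (d / (1 + nrm x) * nrm x)).
    by rewrite ler_wpM2r ?nrm_ge0//; near: g.
  by rewrite mulrAC ltr_pdivrMr// ltr_pM2l// ltrDr.
pose g x := lim ((fun f : bop X Y => f x) @ F).
have gF x : (fun f : bop X Y => f x) @ F --> g x by exact: Fpt.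
have g_lin : linear g.
  move=> k x y; apply: (@cvg_unique _ (@norm_hausdorff _ Y) _ _ _ _ (gF _)).
  have -> : (fun f : bop X Y => f (k *: x + y)) = (fun f => k *: f x + f y).
    by apply/funext => f; exact: bop_linear.
  by apply: cvgD => //; apply: cvgZl_tmp.
have g_le (f : bop X Y) (e : R) : (\forall h \near F, opnorm (f - h) <= e) ->
    forall x, nrm (f x - g x) <= e * nrm x.
  move=> fe x; apply/ler_addgt0Pr => d d0; near F => h.
  rewrite -[f x](subrK (h x)) -addrA (le_trans (nrmD _ _))// lerD//.
    apply: (le_trans (nrm_le_opnorm (f - h) x)).
    by rewrite ler_wpM2r ?nrm_ge0//; near: h.
  rewrite -nrmN opprB -lecR -nrmE; near: h.
  by move/cvgrPdist_le: (gF x); apply; rewrite ltcR.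
have g_bd : exists M : R, forall x, nrm (g x) <= M * nrm x.
  have [f Ff] := Fball 1 ltr01; exists (opnorm f + 1) => x.
  rewrite -(subKr (f x) (g x)) (le_trans (nrmD _ _))// nrmN mulrDl.
  by rewrite lerD ?nrm_le_opnorm// g_le.
pose G : bop X Y := Bop (bounded_linearP g_lin g_bd).
apply/cvg_ex; exists G; apply/cvgrPdist_le => _ /real_complex_gt0[d d0 ->].
have [f Ff] := Fball _ (divr_gt0 d0 (@ltr0Sn R 1)).
near=> h.
rewrite nrmE lecR bop_nrmE -(subrK f G) -addrA (splitr d).
rewrite (le_trans (opnormD _ _))// lerD//; last by near: h.
apply: (@opnorm_le _ _ _ (G - f)); first by rewrite divr_ge0// ltW.
by move=> x; rewrite -nrmN opprB g_le.
Unshelve. all: by end_near. Qed.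

(* Completeness is registered on [bop X R[i]^o] as a whole, because the        *)
(* library only makes [R^o] complete when [R] is a [realType].                 *)
Notation dual_space X := (bop X (_ [i])^o).

HB.instance Definition _ (R : realType) (X : normedModType R[i]) :=
  Uniform_isComplete.Build (dual_space X) (bop_complete (@complex_complete R)).

Section Adjoint.
Context {R : realType} {X : normedModType R[i]}.
Implicit Type T : bop X X.

Lemma adjoint_fun_bounded T (f : dual_space X) :
  (f \o T : X -> R[i]^o) \in bounded_linear.
Proof.
apply: bounded_linearP => [k x y /=|]; first by rewrite !bop_linear.
exists (opnorm f * opnorm T) => x; rewrite -mulrA.
rewrite (le_trans (nrm_le_opnorm f _))//.
by rewrite ler_wpM2l ?opnorm_ge0 ?nrm_le_opnorm.
Qed.

Definition adjoint_fun T (f : dual_space X) : dual_space X :=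
  Bop (adjoint_fun_bounded T f).

Lemma adjoint_bounded T : adjoint_fun T \in bounded_linear.
Proof.
apply: bounded_linearP => [k f g|]; first exact/val_inj/funext.
exists (opnorm T) => f; apply: (@opnorm_le _ _ _ (adjoint_fun T f)).
  by rewrite mulr_ge0 ?opnorm_ge0.
move=> x; rewrite bop_nrmE [opnorm T * _]mulrC -mulrA.
rewrite (le_trans (nrm_le_opnorm f (T x)))//.
by rewrite ler_wpM2l ?opnorm_ge0 ?nrm_le_opnorm.
Qed.

Definition adjoint T : bop (dual_space X) (dual_space X) :=
  Bop (adjoint_bounded T).

End Adjoint.

Record closed_subspace (R : realType) (X : normedModType R[i]) := ClosedSubspace {
  cs_set :> set X ;
  cs_submod : submod_closed (mem cs_set) ;
  cs_closed : closed cs_set }.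

Section ClosedSubspaceType.
Context {R : realType} {X : normedModType R[i]}.
Implicit Type M : closed_subspace X.

Definition cs_pred M : {pred X} := mem (cs_set M).

HB.instance Definition _ M :=
  GRing.isSubmodClosed.Build R[i] X (cs_pred M) (cs_submod M).

Record cs_type M := CsType { cs_val : X ; _ : cs_val \in cs_pred M }.

HB.instance Definition _ M := [isSub for @cs_val M].
HB.instance Definition _ M := [Choice of cs_type M by <:].
HB.instance Definition _ M := [SubChoice_isSubLmodule of cs_type M by <:].

Lemma cs_valP M (x : cs_type M) : cs_set M (cs_val x).
Proof. by have /set_mem := valP x. Qed.

Lemma cs_normD M (x y : cs_type M) :
  `|cs_val (x + y)| <= `|cs_val x| + `|cs_val y|.
Proof. exact: ler_normD. Qed.

Lemma cs_normZ M (k : R[i]) (x : cs_type M) :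
  `|cs_val (k *: x)| = `|k| * `|cs_val x|.
Proof. exact: normrZ. Qed.

Lemma cs_norm_eq0 M (x : cs_type M) : `|cs_val x| = 0 -> x = 0.
Proof. by move/normr0_eq0 => x0; exact: val_inj. Qed.

HB.instance Definition _ M := Lmodule_isNormed.Build R[i] (cs_type M)
  (@cs_normD M) (@cs_normZ M) (@cs_norm_eq0 M).

End ClosedSubspaceType.

Lemma cs_complete (R : realType) (X : completeNormedModType R[i])
    (M : closed_subspace X) (F : set_system (cs_type M)) :
  ProperFilter F -> cauchy F -> cvg F.
Proof.
move=> FF /cauchyP Fc.
have : cvg ((@cs_val _ _ M) @ F).
  apply: cauchy_cvg; apply/cauchyP => e e0; have [x Fx] := Fc e e0.
  exists (cs_val x); rewrite /fmap /=; apply: filterS Fx => y.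
  by rewrite -!ball_normE.
move=> /cvg_ex[l Fl].
have Ml : cs_set M l.
  apply: (closed_cvg (cs_set M)) Fl; first exact: cs_closed.
  by apply: nearW => x; exact: cs_valP.
apply/cvg_ex; exists (CsType (mem_set Ml : l \in cs_pred M)).
apply/cvgrPdist_lt => e e0.
by move/cvgrPdist_lt: Fl => /(_ e e0).
Qed.

HB.instance Definition _ (R : realType) (X : completeNormedModType R[i])
    (M : closed_subspace X) :=
  Uniform_isComplete.Build (cs_type M) (@cs_complete R X M).

Section Restriction.
Context {R : realType} {X : normedModType R[i]}.

Definition invariant (T : bop X X) (M : set X) := T @` M `<=` M.

Context (T : bop X X) (M : closed_subspace X) (TM : invariant T M).

Lemma restriction_subproof (x : cs_type M) : T (cs_val x) \in cs_pred M.
Proof. by apply/mem_set/TM; exists (cs_val x) => //; exact: cs_valP. Qed.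

Definition restriction_fun (x : cs_type M) : cs_type M :=
  CsType (restriction_subproof x).

Lemma restriction_bounded : restriction_fun \in bounded_linear.
Proof.
apply: bounded_linearP => [k x y|].
  by apply: val_inj; exact: (bop_linear T).
by exists (opnorm T) => x; exact: (nrm_le_opnorm T (cs_val x)).
Qed.

Definition restriction : bop (cs_type M) (cs_type M) := Bop restriction_bounded.

End Restriction.

Section Definitions.
Context {R : realType}.

Definition finite_dimensional (X : completeNormedModType R[i]) :=
  exists (n : nat) (e : 'I_n -> X),
    forall x, exists c : 'I_n -> R[i], x = \sum_i c i *: e i.

Definition set_sum (X : completeNormedModType R[i]) (A B : set X) : set X :=
  [set x + y | x in A & y in B].

Definition direct_sum (X : completeNormedModType R[i]) (A B : set X) :=
  set_sum A B = setT /\ A `&` B = [set 0].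

Definition quasinilpotent_part (X : completeNormedModType R[i]) (T : bop X X) : set X :=
  [set x | (fun n : nat => nrm (iter n T x) `^ (n%:R^-1)) @ \oo --> (0 : R)].

(* The sequence starts at index 1: [u 0] is irrelevant.                        *)
Definition analytical_core (X : completeNormedModType R[i]) (T : bop X X) : set X :=
  [set x | exists (u : nat -> X) (delta : R),
    [/\ 0 < delta,
        T (u 1%N) = x,
        forall n : nat, (1 <= n)%N -> T (u n.+1) = u n &
        forall n : nat, (1 <= n)%N -> nrm (u n) <= delta ^+ n * nrm x]].

Definition right_gen_Drazin_invertible (X : completeNormedModType R[i]) (T : bop X X) :=
  closed (analytical_core T) /\
  exists N : closed_subspace X,
    [/\ direct_sum (analytical_core T) N,
        invariant T N & N `<=` quasinilpotent_part T].

Definition semi_regular (Y : completeNormedModType R[i]) (S : bop Y Y) :=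
  closed (range S) /\ forall n, [set y | iter n S y = 0] `<=` range S.

(* Spectral radius zero, the spectral radius being given by Gelfand's formula; *)
(* an operator on the zero space qualifies.                                    *)
Definition quasinilpotent (Y : completeNormedModType R[i]) (S : bop Y Y) :=
  (fun n : nat => opnorm (iter n S) `^ (n%:R^-1)) @ \oo --> (0 : R).

Record generalized_Kato_decomposition (X : completeNormedModType R[i]) (T : bop X X)
    (M N : closed_subspace X) : Prop := GeneralizedKatoDecomposition {
  GKD_direct_sum : direct_sum M N ;
  GKD_invl : invariant T M ;
  GKD_invr : invariant T N ;
  GKD_semi_regular : semi_regular (restriction GKD_invl) ;
  GKD_quasinilpotent : quasinilpotent (restriction GKD_invr) }.

(* [f] is total, but only its germs at the points of the (open) set [U] count. *)
Definition analytic_on (Y : completeNormedModType R[i]) (U : set R[i]^o)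
    (f : R[i]^o -> Y) :=
  forall z0, U z0 -> exists a : nat -> Y, \forall z \near z0,
    series (fun n => (z - z0) ^+ n *: a n) @ \oo --> f z.

Definition SVEP_at (Y : completeNormedModType R[i]) (S : bop Y Y) (l0 : R[i]) :=
  forall U : set R[i]^o, open U -> connected U -> U l0 ->
  forall f : R[i]^o -> Y, analytic_on U f ->
    (forall l, U l -> l *: f l - S (f l) = 0) -> forall l, U l -> f l = 0.

End Definitions.

(* Main.v *)
Require Import Defs.
From mathcomp Require Import all_boot all_order all_algebra.
From mathcomp Require Import all_classical all_reals all_analysis.
From mathcomp Require Import complex ring lra.

(** Let [(M, N)] be a generalized Kato decomposition of [T]. All five
assertions say that [T] maps [M] onto itself.

If it does, the open mapping theorem yields backward orbits of geometric growth
in [M], so [M] lies in the core ([sub_analytical_core]); the reverse inclusion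
always holds, because the components along [N] of a backward orbit grow at most
geometrically and the powers of [T] on [N] decay faster than any geometric
sequence ([analytical_core_sub]). Since [N] lies in the quasinilpotent part, the space
is then the sum of the core and the quasinilpotent part.

Conversely, suppose that this sum is dense. For a semi-regular operator every
point [x] with [nrm (T ^ n x)] of growth rate zero lies in the range: lifting
[T ^ n x] back [n] times within the range gives a small [z], and [x - z] is in
the null space of [T ^ n], hence in the range
([quasinilpotent_part_sub_range]). So the sum is contained in [T(M) + N], which
is closed, and [T(M) = M] ([dense_core_surj]).

The extension property of the adjoint [T'] is linked to surjectivity by duality.
If [T(M)] is a proper subspace of [M], then a functional that vanishes on
[T(M) + N] has an infinite chain of lifts through [T'], of geometric growth,
because semi-regularity makes each lift vanish on the null spaces of all powers
of [T]. The power series with these coefficients is a nonzero analytic solution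
of [(l - T') f(l) = 0] near [0] ([SVEP_surj]). If [T(M) = M], a solution
vanishes on [N] for [l] nonzero by quasinilpotence, and on [M] for [l] small by
means of backward orbits, hence everywhere by the identity theorem
([surj_SVEP]).

Finally, if [T] is right generalized Drazin invertible, then [M := K(T)]
together with [N] is a generalized Kato decomposition: [T] maps the core onto
itself, and the uniform boundedness principle turns [N] being inside the
quasinilpotent part into quasinilpotence of the restriction to [N]
([sub_quasinilpotent_on]).

The analytic tools are a lemma on absorbing sigma-convex sets in Banach spaces
([sigma_convex_nbhs0]), which stands for the usual consequences of Baire's
theorem, a Hahn-Banach theorem for functionals given by their graphs
([hahn_banach_graph]), and the elementary theory of vector-valued power
series. *)

Import Order.TTheory GRing.Theory Num.Theory.
Import numFieldNormedType.Exports.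

Set Implicit Arguments.
Unset Strict Implicit.
Unset Printing Implicit Defensive.

Local Open Scope classical_set_scope.
Local Open Scope complex_scope.
Local Open Scope ring_scope.

(** * Convergence in terms of the real-valued norm *)

Lemma series0 (V : zmodType) (u : nat -> V) : series u 0%N = 0.
Proof. by rewrite /series /= big_geq. Qed.

Section NormConvergence.
Context {R : realType} {X : normedModType R[i]}.
Implicit Types (x y : X) (u s : nat -> X).

Lemma nrmC (t : R) : nrm (t%:C : R[i]^o) = `|t|.
Proof. by rewrite /nrm normc_def /= expr0n addr0 sqrtr_sqr. Qed.

Lemma nrm_scale (k : R[i]) x : nrm (k *: x) = nrm (k : R[i]^o) * nrm x.
Proof. exact: nrmZ. Qed.

Lemma nrm_scaleR (t : R) x : nrm (t%:C *: x) = `|t| * nrm x.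
Proof. by rewrite nrm_scale nrmC. Qed.

Lemma nrmB x y : nrm (x - y) = nrm (y - x).
Proof. by rewrite -nrmN opprB. Qed.

Lemma nbhs_nrmP x (A : set X) :
  nbhs x A <-> exists2 e : R, 0 < e & forall y, nrm (x - y) < e -> A y.
Proof.
rewrite -nbhs_ballE; split.
  case=> e /= /real_complex_gt0[d d0 ->] dA; exists d => // y xy.
  by apply: dA; rewrite -ball_normE /ball_ /= nrmE ltcR.
case=> e e0 eA; exists e%:C; first by rewrite /= ltcR.
by move=> y; rewrite -ball_normE /ball_ /= nrmE ltcR => /eA.
Qed.

Lemma cvg_nrmP u x :
  u @ \oo --> x <-> (fun n => nrm (x - u n)) @ \oo --> (0 : R).
Proof.
split.
  move=> /cvgrPdist_lt ux; apply/cvgrPdist_lt => e e0.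
  have := ux e%:C; rewrite ltcR => /(_ e0); apply: filterS => n.
  by rewrite nrmE ltcR sub0r normrN ger0_norm ?nrm_ge0.
move=> /cvgrPdist_lt ux; apply/cvgrPdist_lt => _ /real_complex_gt0[d d0 ->].
apply: filterS (ux d d0) => n.
by rewrite nrmE ltcR sub0r normrN ger0_norm ?nrm_ge0.
Qed.

Lemma cvg_nrm_le u x (r : nat -> R) :
  (forall n, nrm (x - u n) <= r n) -> r @ \oo --> (0 : R) -> u @ \oo --> x.
Proof.
move=> ur r0; apply/cvg_nrmP; apply: (@squeeze_cvgr _ _ _ _ (fun=> 0) r) => //.
  by apply: nearW => n; rewrite nrm_ge0 ur.
exact: cvg_cst.
Qed.

Lemma nrm_cvg_le u x y (c : R) : u @ \oo --> x ->
  (\forall n \near \oo, nrm (y - u n) <= c) -> nrm (y - x) <= c.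
Proof.
move=> /cvg_nrmP/cvgrPdist_lt ux uc; apply/ler_addgt0Pr => e e0.
near \oo => n.
have -> : y - x = (y - u n) - (x - u n) by rewrite opprB addrA subrK.
rewrite (le_trans (nrmD _ _))// nrmN lerD//; first by near: n.
have : `|0 - nrm (x - u n)| < e by near: n; exact: ux.
by rewrite sub0r normrN ger0_norm ?nrm_ge0// => /ltW.
Unshelve. all: by end_near. Qed.

Lemma closed_cvg_seq (A : set X) u x : closed A -> (forall n, A (u n)) ->
  u @ \oo --> x -> A x.
Proof. by move=> Ac Au; apply: closed_cvg => //; apply: nearW. Qed.

Lemma closure_nrmP (A : set X) x : closure A x <->
  forall e : R, 0 < e -> exists2 y, A y & nrm (x - y) < e.
Proof.
split=> [xA e e0|xA B /nbhs_nrmP[e e0 eB]].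
  have [] := xA [set y | nrm (x - y) < e]; first by apply/nbhs_nrmP; exists e.
  by move=> y [Ay xy]; exists y.
by have [y Ay xy] := xA _ e0; exists y; split => //; exact: eB.
Qed.

Lemma closed_nrmP (A : set X) : closed A <->
  forall x, (forall e : R, 0 < e -> exists2 y, A y & nrm (x - y) < e) -> A x.
Proof.
split=> [Ac x /closure_nrmP/Ac //|H x /closure_nrmP]; exact: H.
Qed.

Lemma cvg_seq_unique u x y : u @ \oo --> x -> u @ \oo --> y -> x = y.
Proof. exact: (@cvg_unique _ (@norm_hausdorff _ X)). Qed.

End NormConvergence.

Lemma nrmM (R : realType) (k l : R[i]) :
  nrm (k * l : R[i]^o) = nrm (k : R[i]^o) * nrm (l : R[i]^o).
Proof. exact: (@nrm_scale R R[i]^o k l). Qed.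


Section Bop.
Context {R : realType} {X Y : normedModType R[i]}.
Implicit Types (f : bop X Y) (x y : X).

Lemma bopD f x y : f (x + y) = f x + f y.
Proof. exact: (linearD f). Qed.

Lemma bopZ f (k : R[i]) x : f (k *: x) = k *: f x.
Proof. exact: (linearZZ f). Qed.

Lemma bopB f x y : f (x - y) = f x - f y.
Proof. exact: (linearB f). Qed.

Lemma bop_scaleE f (k : R[i]) x : (k *: f) x = k *: f x.
Proof. by []. Qed.

Lemma bop_cvg f (u : nat -> X) x : u @ \oo --> x -> (fun n => f (u n)) @ \oo --> f x.
Proof.
move=> /cvg_nrmP ux; apply: (@cvg_nrm_le _ _ _ _ (fun n => opnorm f * nrm (x - u n))).
  by move=> n; rewrite -linearB nrm_le_opnorm.
by rewrite -[X in _ --> X](mulr0 (opnorm f)); apply: cvgMr.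
Qed.

End Bop.

Arguments bop_cvg {R X Y} f {u x}.

Section Completeness.
Context {R : realType} {X : completeNormedModType R[i]}.
Implicit Types (u s : nat -> X).

(** Completeness in the form used throughout: a sequence with an explicit null
sequence of tail bounds converges, and the limit inherits the bounds. *)
Lemma cvg_of_tails s (r : nat -> R) : r @ \oo --> (0 : R) ->
  (forall m n, (n <= m)%N -> nrm (s m - s n) <= r n) ->
  exists2 x, s @ \oo --> x & forall n, nrm (x - s n) <= r n.
Proof.
move=> r0 sr.
have : cvg (s @ \oo).
  apply: cauchy_cvg; apply/cauchyP => _ /real_complex_gt0[d d0 ->].
  have /cvgrPdist_lt/(_ _ d0)[N _ rN] := r0.
  exists (s N); exists N => // m /= Nm.
  rewrite -ball_normE /ball_ /= nrmE ltcR nrmB (le_lt_trans (sr _ _ Nm))//.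
  have := rN N (leqnn N); rewrite /= sub0r normrN.
  exact/le_lt_trans/ler_norm.
move=> /cvg_ex[x sx]; exists x => // n.
rewrite nrmB; apply: (nrm_cvg_le sx).
by exists n => // m /= nm; rewrite nrmB sr.
Qed.

Lemma sum_geometric_tail (q : R) n m : 0 <= q -> q < 1 -> (n <= m)%N ->
  \sum_(n <= k < m) q ^+ k <= q ^+ n / (1 - q).
Proof.
move=> q0 q1 nm; rewrite ler_pdivlMr ?subr_gt0//.
suff -> : (\sum_(n <= k < m) q ^+ k) * (1 - q) = q ^+ n - q ^+ m.
  by rewrite gerBl exprn_ge0.
rewrite mulr_suml (@telescope_sumr_eq _ _ _ (fun k => - q ^+ k) _ nm).
  by rewrite opprK addrC.
by move=> k _; rewrite mulrBr mulr1 -exprSr opprK addrC.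
Qed.

Lemma cvg_geometric_bound (c q : R) : 0 <= q -> q < 1 ->
  (fun n => c * (q ^+ n / (1 - q))) @ \oo --> (0 : R).
Proof.
move=> q0 q1; rewrite -[X in _ --> X](mulr0 c); apply: cvgMr.
rewrite -[X in _ --> X](mul0r (1 - q)^-1); apply: cvgMl.
by apply: cvg_expr; rewrite ger0_norm.
Qed.

Lemma le_geometric_le0 (a b q : R) : 0 <= q -> q < 1 ->
  (forall n, a <= b * q ^+ n) -> a <= 0.
Proof.
move=> q0 q1 aq; apply/ler_addgt0Pr => e e0; rewrite add0r.
have : geometric b q @ \oo --> (0 : R) by apply: cvg_geometric; rewrite ger0_norm.
move=> /cvgrPdist_lt/(_ _ e0)[n _ /(_ n (leqnn n))] /=.
rewrite sub0r normrN => /(le_lt_trans (ler_norm _))/ltW.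
exact: le_trans.
Qed.

Lemma geometric_series_cvg u (c q : R) : 0 <= q -> q < 1 ->
  (forall n, nrm (u n) <= c * q ^+ n) ->
  exists2 x, series u @ \oo --> x &
    forall n, nrm (x - series u n) <= c * (q ^+ n / (1 - q)).
Proof.
move=> q0 q1 uq; apply: cvg_of_tails; first exact: cvg_geometric_bound.
have c0 : 0 <= c.
  by have := uq 0%N; rewrite expr0 mulr1; apply/le_trans/nrm_ge0.
move=> m n nm.
rewrite sub_series_geq//.
have : nrm (\sum_(n <= k < m) u k) <= \sum_(n <= k < m) c * q ^+ k.
  elim/big_ind2: _ => //; first by rewrite nrm0.
  by move=> x1 x2 y1 y2 h1 h2; rewrite (le_trans (nrmD _ _))// lerD.
move=> /le_trans; apply; rewrite -mulr_sumr ler_wpM2l//.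
exact: sum_geometric_tail.
Qed.

End Completeness.

(** * Sigma-convex sets in Banach spaces *)

Section SigmaConvex.
Context {R : realType} {X : completeNormedModType R[i]}.

(** Baire's theorem for a countable cover. If no closure contains a ball, then
every ball contains a smaller one, of at most half the radius, that misses the
next set of the cover; the centres of the nested balls converge to a point
that no set of the cover contains. *)
Lemma baire_cover (F : nat -> set X) : (forall x, exists n, F n x) ->
  exists n y (r : R), 0 < r /\ forall z, nrm (z - y) < r -> closure (F n) z.
Proof.
move=> FX; apply: contrapT => nF.
have step (nyr : nat * (X * R)) : exists zs : X * R, 0 < nyr.2.2 ->
    [/\ 0 < zs.2, zs.2 <= nyr.2.2 / 2, nrm (zs.1 - nyr.2.1) + zs.2 <= nyr.2.2 &
        forall x, nrm (zs.1 - x) <= zs.2 -> ~ F nyr.1 x].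
  case: nyr => n [y r] /=.
  have [r0|] := ltP 0 r; last by exists (y, r).
  have [z zy zF] : exists2 z, nrm (z - y) < r & ~ closure (F n) z.
    apply: contrapT => H; apply: nF; exists n, y, r; split=> // z zy.
    by apply: contrapT => zF; apply: H; exists z.
  have [e e0 eF] : exists2 e : R, 0 < e & forall x, F n x -> e <= nrm (z - x).
    apply: contrapT => H; apply: zF; apply/closure_nrmP => e e0.
    apply: contrapT => G; apply: H; exists e => // x Fx.
    by rewrite leNgt; apply/negP => zx; apply: G; exists x.
  exists (z, Num.min (e / 2) (Num.min (r / 2) (r - nrm (z - y)))) => _ /=.
  split.
  - by rewrite !lt_min !divr_gt0// subr_gt0.
  - by rewrite !ge_min lexx orbT.
  - by rewrite -lerBrDl !ge_min lexx !orbT.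
  - move=> x; rewrite !le_min => /andP[xe _] /eF.
    by move: xe e0; move: (nrm _) => t; lra.
have [f fP] := choice step.
pose s := fix s n := if n is m.+1 then f (m, s m) else (0 : X, 1 : R).
have s0 n : 0 < (s n).2.
  by elim: n => //= n /(fP (n, s n))[].
have sP n := fP (n, s n) (s0 n).
have rle n : (s n).2 <= (2^-1) ^+ n.
  elim: n => [|n IH]; first by rewrite expr0.
  have [_ + _ _] := sP n => /= /le_trans; apply.
  by rewrite exprS mulrC ler_wpM2l// invr_ge0.
have dist m n : (n <= m)%N -> nrm ((s m).1 - (s n).1) + (s m).2 <= (s n).2.
  move=> /subnK<-; elim: (m - n)%N => [|k IH].
    by rewrite add0n subrr nrm0 add0r.
  have [_ _ + _] := sP (k + n)%N => /=; move: IH => /=.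
  set a := f _; set b := s _ => IH1 IH2.
  have -> : a.1 - (s n).1 = (a.1 - b.1) + (b.1 - (s n).1) by rewrite addrA subrK.
  by have := nrmD (a.1 - b.1) (b.1 - (s n).1); move: IH1 IH2; lra.
have [|m n nm|x sx xle] := @cvg_of_tails _ _ (fun n => (s n).1) (fun n => (s n).2).
- apply: (@squeeze_cvgr _ _ _ _ (fun=> 0) (fun n => (2^-1) ^+ n)).
  + by apply: nearW => n; rewrite ltW//= rle.
  + exact: cvg_cst.
  + by apply: cvg_expr; rewrite ger0_norm// invf_lt1// ltr1n.
- by have := dist _ _ nm; have := s0 m; lra.
have [n Fx] := FX x.
have [_ _ _ /(_ x)] := sP n; apply => //.
by rewrite nrmB; exact: (xle n.+1).
Qed.

(** The one consequence of completeness behind all the uniform bounds below.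
By Baire's theorem the closure of [K] contains a ball, and by symmetry and
convexity a ball around the origin. A point [x] of that ball is within half
the radius of some [u 0] in [K]; doubling the error and repeating gives
[x / 2] as the sum of the [u n / 2 ^ n.+1], so that sigma-convexity removes the
closure. Suitable choices of [K] give the open mapping theorem, the closed graph
theorem and the uniform boundedness principle. *)
Lemma sigma_convex_nbhs0 (K : set X) :
    (forall x, exists n : nat, K ((n.+1%:R^-1)%:C *: x)) ->
    (forall x, K x -> K (- x)) ->
    (forall (u : nat -> X) x, (forall n, K (u n)) ->
      series (fun n => (2^-1 ^+ n.+1)%:C *: u n) @ \oo --> x -> K x) ->
  exists2 d : R, 0 < d & forall x, nrm x <= d -> K x.
Proof.
move=> Kabs Ksym Kconv.
have halfD : (2^-1 : R)%:C + (2^-1 : R)%:C = 1 :> R[i].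
  by rewrite -rmorphD -[2^-1]mul1r -splitr rmorph1.
have half_dbl (x : X) : (2^-1)%:C *: x + (2^-1)%:C *: x = x.
  by rewrite -scalerDl halfD scale1r.
have cvg_half (c : R) : (fun n => c * 2^-1 ^+ n) @ \oo --> (0 : R).
  by apply: cvg_geometric; rewrite ger0_norm// invf_lt1// ltr1n.
have Kmid u v : K u -> K v -> K ((2^-1)%:C *: (u + v)).
  move=> Ku Kv; apply: (Kconv (fun n => if n is 0%N then u else v)) => [[]//|].
  set s := series _; have sE n : s n.+1 =
      (2^-1)%:C *: (u + v) - (2^-1 ^+ n.+1)%:C *: v.
    elim: n => [|n IH].
      by rewrite /s seriesSr series0 add0r expr1 scalerDr addrK.
    rewrite /s seriesSr -/s IH.
    have -> : (2^-1 ^+ n.+1)%:C *: v =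
        (2^-1 ^+ n.+2)%:C *: v + (2^-1 ^+ n.+2)%:C *: v.
      by rewrite -scalerDl -rmorphD; congr (_%:C *: _); rewrite [in RHS]exprS; field.
    by rewrite opprD addrA subrK.
  rewrite -(cvg_shiftS s); apply: (@cvg_nrm_le _ _ _ _ (fun n => nrm v * 2^-1 ^+ n)).
    move=> n; rewrite [X in _ - X]sE subKr nrm_scaleR mulrC ger0_norm ?exprn_ge0//.
    rewrite ler_wpM2l ?nrm_ge0// exprS ler_piMl ?exprn_ge0//.
    by rewrite invf_le1// ler1n.
  exact: cvg_half.
have [n [y [r [r0 yr]]]] := baire_cover Kabs.
pose d : R := r / n.+1%:R.
have d0 : 0 < d by rewrite divr_gt0.
(* The midpoint of two opposite balls is a ball around the origin. *)
have near0 z : nrm z < d ->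
    forall e : R, 0 < e -> exists2 u, K u & nrm (z - u) < e.
  move=> zd e e0.
  have nE : n.+1%:R^-1%:C * n.+1%:R%:C = 1 :> R[i].
    by rewrite -rmorphM mulVf ?pnatr_eq0// rmorph1.
  have approx w : nrm w < d -> exists2 u, K u &
      nrm ((n.+1%:R^-1)%:C *: y + w - u) < e.
    move=> wd; have : closure (fun x => K (n.+1%:R^-1%:C *: x)) (y + n.+1%:R%:C *: w).
      apply: yr; rewrite [y + _]addrC addrK nrm_scaleR ger0_norm//.
      by rewrite -ltr_pdivlMl// mulrC.
    move=> /closure_nrmP/(_ (e * n.+1%:R))[|k Kk kE]; first by rewrite mulr_gt0.
    exists ((n.+1%:R^-1)%:C *: k) => //.
    rewrite -[w in X in X < _](scale1r) -nE -scalerA -scalerDr -scalerBr.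
    by rewrite nrm_scaleR ger0_norm ?invr_ge0// mulrC ltr_pdivrMr.
  have [u Ku uz] := approx z zd.
  have [|v Kv vz] := approx (- z); first by rewrite nrmN.
  exists ((2^-1)%:C *: (u - v)); first by apply: Kmid => //; exact: Ksym.
  set c := _ *: y in uz vz.
  have -> : z - (2^-1)%:C *: (u - v) =
      (2^-1)%:C *: ((c + z - u) - (c - z - v)).
    rewrite -[in LHS](half_dbl z) -scalerDr -scalerBr; congr (_ *: _).
    rewrite (opprB (c - z)) [v - _]addrC (opprB c) (addrACA (c + z)).
    by rewrite [c + z]addrC (addrACA z) subrr addr0 opprB [v - u]addrC.
  rewrite nrm_scaleR ger0_norm ?invr_ge0//.
  by have := nrmD (c + z - u) (- (c - z - v)); rewrite nrmN; move: uz vz; lra.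
have step z : exists u, nrm z < d -> K u /\ nrm (z - u) < d / 2.
  have [zd|] := ltP (nrm z) d; last by exists 0.
  by have [u Ku zu] := near0 z zd _ (divr_gt0 d0 (ltr0Sn R 1)); exists u.
have [f fP] := choice step.
(* [z k] is the error after [k] approximations, rescaled by [2 ^ k]. *)
have main x : nrm x < d -> K ((2^-1)%:C *: x).
  move=> xd; pose z := fix z k := if k is j.+1 then 2%:C *: (z j - f (z j)) else x.
  have zd k : nrm (z k) < d.
    elim: k => //= k /fP[_]; rewrite nrm_scaleR ger0_norm//.
    by move: (nrm _) => t; lra.
  apply: (Kconv (fun k => f (z k))) => [k|]; first by have [] := fP _ (zd k).
  set s := series _.
  have sE k : s k = (2^-1)%:C *: x - (2^-1 ^+ k.+1)%:C *: z k.
    elim: k => [|k IH]; first by rewrite /s series0 expr1 subrr.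
    rewrite /s seriesSr -/s IH.
    rewrite [in RHS]exprSr [in RHS]rmorphM -[in RHS]scalerA [in RHS](scalerA _ 2%:C).
    rewrite -[in RHS]rmorphM mulVf// rmorph1 scale1r scalerBr opprB addrA.
    by rewrite addrAC.
  apply: (@cvg_nrm_le _ _ _ _ (fun n => d * 2^-1 ^+ n)) => // k.
  rewrite sE subKr nrm_scaleR mulrC ger0_norm ?exprn_ge0//.
  apply: ler_pM; rewrite ?nrm_ge0 ?exprn_ge0//; first exact: ltW.
  by rewrite exprS ler_piMl ?exprn_ge0// invf_le1// ler1n.
exists (d / 4) => [|x xd]; first by rewrite divr_gt0.
have -> : x = (2^-1)%:C *: (2%:C *: x).
  by rewrite scalerA -rmorphM mulVf// rmorph1 scale1r.
by apply: main; rewrite nrm_scaleR ger0_norm//; move: xd d0; lra.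
Qed.

End SigmaConvex.

(** * Closed subspaces, open mappings and direct sums *)

Section ClosedSubspaceLemmas.
Context {R : realType} {X : normedModType R[i]} (M : closed_subspace X).
Implicit Types x y : X.

Lemma cs0 : cs_set M 0.
Proof. exact/set_mem/(@rpred0 _ (cs_pred M)). Qed.

Lemma csD x y : cs_set M x -> cs_set M y -> cs_set M (x + y).
Proof. by move=> /mem_set Mx /mem_set My; exact/set_mem/(@rpredD _ (cs_pred M)). Qed.

Lemma csZ (k : R[i]) x : cs_set M x -> cs_set M (k *: x).
Proof. by move=> /mem_set Mx; exact/set_mem/(@rpredZ _ _ (cs_pred M)). Qed.

Lemma csN x : cs_set M x -> cs_set M (- x).
Proof. by rewrite -scaleN1r; exact: csZ. Qed.

Lemma csB x y : cs_set M x -> cs_set M y -> cs_set M (x - y).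
Proof. by move=> Mx /csN; exact: csD. Qed.

Definition cs_of x (Mx : cs_set M x) : cs_type M := CsType (mem_set Mx : x \in cs_pred M).

End ClosedSubspaceLemmas.

Section OpenMapping.
Context {R : realType} {A X : completeNormedModType R[i]}.

Lemma exists_natS_ge (x : R) : exists n : nat, x <= n.+1%:R.
Proof.
exists (Num.bound `|x|); rewrite (le_trans (ler_norm x))// ltW//.
by rewrite (lt_trans (archi_boundP (normr_ge0 x)))// ltr_nat.
Qed.

(** The open mapping theorem for closed linear relations rather than for
operators: the graph of a bounded operator and the graph of the inverse of a
projection are both instances. [K] is the image of the unit ball. *)
Lemma closed_relation_bounded_inverse (G : A -> X -> Prop) :
    (forall k a b x y, G a x -> G b y -> G (k *: a + b) (k *: x + y)) ->
    (forall (u : nat -> A) (v : nat -> X) a x, (forall n, G (u n) (v n)) ->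
      u @ \oo --> a -> v @ \oo --> x -> G a x) ->
    (forall x, exists a, G a x) ->
  exists2 C : R, 0 < C & forall x, exists2 a, G a x & nrm a <= C * nrm x.
Proof.
move=> Glin Gcl Gonto.
have G00 : G 0 0.
  by have [a Ga] := Gonto 0; have := Glin (-1) _ _ _ _ Ga Ga; rewrite !scaleN1r !addNr.
have GD a b x y : G a x -> G b y -> G (a + b) (x + y).
  by move=> Ga Gb; have := Glin 1 _ _ _ _ Ga Gb; rewrite !scale1r.
have GZ k a x : G a x -> G (k *: a) (k *: x).
  by move=> Ga; have := Glin k _ _ _ _ Ga G00; rewrite !addr0.
pose K := [set x | exists2 a, G a x & nrm a <= 1].
have [x|x [a Ga a1]|u x Ku ux|d d0 dK] := @sigma_convex_nbhs0 _ X K.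
- have [a Ga] := Gonto x; have [n an] := exists_natS_ge (nrm a).
  exists n, ((n.+1%:R^-1)%:C *: a); first exact: GZ.
  by rewrite nrm_scaleR ger0_norm ?invr_ge0// ler_pdivrMl// mulr1.
- by exists (- a); rewrite ?nrmN// -(scaleN1r a) -(scaleN1r x); exact: GZ.
- have Kn n : exists a, G a (u n) /\ nrm a <= 1 by have [a ? ?] := Ku n; exists a.
  have [a aP] := choice Kn.
  have [|||b sb bE] := @geometric_series_cvg _ _
    (fun n => (2^-1 ^+ n.+1)%:C *: a n) 2^-1 2^-1.
  + by rewrite invr_ge0.
  + by rewrite invf_lt1// ltr1n.
  + move=> n; rewrite nrm_scaleR ger0_norm ?exprn_ge0// exprS.
    rewrite ler_piMr ?mulr_ge0 ?exprn_ge0//.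
    by have [] := aP n.
  exists b; last first.
    have := bE 0%N; rewrite series0 subr0 => /le_trans; apply.
    rewrite expr0 mul1r (_ : 1 - 2^-1 = 2^-1 :> R); last by field.
    by rewrite mulfV ?invr_eq0.
  apply: Gcl sb ux => n; elim: n => [|n IH]; first by rewrite !series0.
  by rewrite !seriesSr; apply: GD => //; apply: GZ; have [] := aP n.
exists d^-1 => [|x]; first by rewrite invr_gt0.
have [x0|x0] := eqVneq (nrm x) 0.
  by exists 0; rewrite ?nrm0 ?mulr_ge0 ?invr_ge0 ?nrm_ge0 ?ltW// (nrm_eq0 x0).
have xp : 0 < nrm x by rewrite lt_neqAle eq_sym x0 nrm_ge0.
have dx : 0 < d / nrm x by rewrite divr_gt0.
have xd : 0 < nrm x / d by rewrite divr_gt0.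
have [|a Ga a1] := dK ((d / nrm x)%:C *: x).
  by rewrite nrm_scaleR gtr0_norm// divfK.
exists ((nrm x / d)%:C *: a); last first.
  by rewrite nrm_scaleR gtr0_norm// [d^-1 * _]mulrC ler_piMr// ltW.
rewrite [x in G _ x](_ : x = (nrm x / d)%:C *: ((d / nrm x)%:C *: x)); first exact: GZ.
rewrite scalerA -rmorphM mulrA divfK ?gt_eqF// divff// rmorph1 scale1r//.
Qed.

End OpenMapping.

Section DirectSum.
Context {R : realType} {X : completeNormedModType R[i]}.

Lemma direct_sum_eq0 (M N : closed_subspace X) x : direct_sum M N ->
  cs_set M x -> cs_set N x -> x = 0.
Proof. by case=> _ MN Mx Nx; have : (M `&` N) x by []; rewrite MN. Qed.

Lemma direct_sum_decomp (M N : set X) x : set_sum M N = setT ->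
  exists m n, [/\ M m, N n & x = m + n].
Proof.
move=> MN; have : set_sum M N x by rewrite MN.
by case=> m Mm [n Nn <-]; exists m, n.
Qed.

Lemma direct_sum_sym (M N : set X) :
  direct_sum M N -> direct_sum N M.
Proof.
case=> MN1 MN0; split; last by rewrite setIC.
apply/seteqP; split=> // x _; have [m [n [Mm Nn ->]]] := direct_sum_decomp x MN1.
by exists n => //; exists m => //; rewrite addrC.
Qed.

Lemma direct_sum_uniq (M N : closed_subspace X) m n m' n' : direct_sum M N ->
  cs_set M m -> cs_set N n -> cs_set M m' -> cs_set N n' ->
  m + n = m' + n' -> m = m' /\ n = n'.
Proof.
move=> MN Mm Nn Mm' Nn' E.
have mm' : m = m'.
  apply/eqP; rewrite -subr_eq0; apply/eqP/(direct_sum_eq0 MN); first exact: csB.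
  have -> : m - m' = n' - n; last exact: csB.
  by apply/eqP; rewrite subr_eq addrAC eq_sym subr_eq addrC -E addrC.
by split=> //; move: E; rewrite mm' => /addrI.
Qed.

(** The projection onto [M] along [N] is bounded: this is the closed graph
theorem for the relation [x - a \in N] between [a] in [M] and [x] in [X]. *)
Lemma direct_sum_bounded_projection (M N : closed_subspace X) : direct_sum M N ->
  exists2 C : R, 0 < C & forall m n, cs_set M m -> cs_set N n -> nrm m <= C * nrm (m + n).
Proof.
move=> MN.
have [|||C C0 CP] := @closed_relation_bounded_inverse R (cs_type M) X
    (fun a x => cs_set N (x - cs_val a)).
- move=> k a b x y Na Nb; have := csD (csZ k Na) Nb.
  by rewrite scalerBr opprD addrACA.
- move=> u v a x Nuv ua vx; apply: (closed_cvg_seq (@cs_closed _ _ N) Nuv).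
  by apply: cvgB => //; apply/cvg_nrmP; exact: (cvg_nrmP u a).1 ua.
- move=> x; have [m [n [Mm Nn ->]]] := direct_sum_decomp x MN.1.
  by exists (cs_of Mm); rewrite /= addrC addKr.
exists C => // m n Mm Nn; have [a Na aC] := CP (m + n).
suff mE : m = cs_val a by rewrite [in X in X <= _]mE.
have := direct_sum_uniq MN Mm Nn (cs_valP a) Na.
by rewrite [cs_val a + _]addrC subrK => /(_ erefl)[].
Qed.

(** Bounded choice of preimages, from the open mapping theorem for [T] seen as an
operator from [M] onto the Banach space [T @` M]. *)
Lemma closed_range_lift (T : bop X X) (M : closed_subspace X) : closed (T @` M) ->
  exists2 C : R, 0 < C & forall x, cs_set M x ->
    exists y, [/\ cs_set M y, T y = T x & nrm y <= C * nrm (T x)].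
Proof.
move=> Wcl.
have Wsub : submod_closed (mem (T @` M)).
  split; first by apply/mem_set; exists 0; rewrite ?linear0//; exact: cs0.
  move=> k _ _ /set_mem[x Mx <-] /set_mem[y My <-]; apply/mem_set.
  by exists (k *: x + y); rewrite ?linearP//; apply/csD => //; exact: csZ.
pose W := ClosedSubspace Wsub Wcl.
have [|||C C0 CP] := @closed_relation_bounded_inverse R (cs_type M) (cs_type W)
    (fun a y => T (cs_val a) = cs_val y).
- by move=> k a b x y /= Ta Tb; rewrite -Ta -Tb; exact: bop_linear.
- move=> u v a x Tuv ua vx.
  have ua' : (fun n => cs_val (u n)) @ \oo --> cs_val a.
    by apply/cvg_nrmP; exact: (cvg_nrmP u a).1 ua.
  apply: (cvg_seq_unique (bop_cvg T ua')).
  rewrite (_ : (fun n => _) = fun n => cs_val (v n)); last exact/funext.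
  by apply/cvg_nrmP; exact: (cvg_nrmP v x).1 vx.
- by move=> y; have [x Mx xy] := cs_valP y; exists (cs_of Mx).
exists C => // x Mx.
have Wx : cs_set W (T x) by exists x.
have [a Ta aC] := CP (cs_of Wx).
by exists (cs_val a); split => //; exact: cs_valP.
Qed.

End DirectSum.

(** * Growth rates and quasinilpotence *)

Section RootTest.
Context {R : realType}.

Lemma root_leP (a e : R) (n : nat) : (0 < n)%N -> 0 <= a -> 0 <= e ->
  (a `^ n%:R^-1 <= e) = (a <= e ^+ n).
Proof.
move=> n0 a0 e0; rewrite -(@ler_pXn2r _ n)// ?nnegrE ?powR_ge0//.
by rewrite -[X in X <= _]powR_mulrn ?powR_ge0// -powRrM mulVf ?pnatr_eq0 -?lt0n// powRr1.
Qed.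

(** The root test without roots: the growth rate is zero exactly when the
sequence is dominated by every geometric sequence. *)
Lemma root_cvg0P (a : nat -> R) : (forall n, 0 <= a n) ->
  ((fun n => a n `^ (n%:R^-1)) @ \oo --> (0 : R)) <->
  (forall e : R, 0 < e -> exists C : R, forall n, a n <= C * e ^+ n).
Proof.
move=> a0; split=> [/cvgrPdist_lt ra e e0|ra].
  have [N _ NP] := ra e e0.
  exists (1 + \sum_(k < N.+1) a k / e ^+ k) => n.
  have en : 0 < e ^+ n by rewrite exprn_gt0.
  have S0 (k : 'I_N.+1) : 0 <= a k / e ^+ k by rewrite divr_ge0// exprn_ge0// ltW.
  rewrite -ler_pdivrMr//; have [nN|Nn] := ltnP n N.+1.
    rewrite (bigD1 (Ordinal nN))//= addrCA lerDl addr_ge0// sumr_ge0//.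
  apply: (@le_trans _ _ 1); last by rewrite lerDl sumr_ge0.
  rewrite ler_pdivrMr// mul1r; have := NP n (ltnW Nn).
  rewrite /= sub0r normrN ger0_norm ?powR_ge0// => /ltW.
  by rewrite root_leP//; [exact: leq_trans Nn|exact: ltW].
apply/cvgrPdist_lt => e e0.
have [C CP] := ra (e / 4) (divr_gt0 e0 (ltr0Sn R 3)).
have [N CN] := exists_natS_ge C.
exists N.+1 => // n /= Nn; have n0 : (0 < n)%N by exact: leq_trans Nn.
rewrite sub0r normrN ger0_norm ?powR_ge0//.
apply: (@le_lt_trans _ _ (e / 2)); last by rewrite ltr_pdivrMr// ltr_pMr// ltr1n.
have e4 : 0 <= e / 4 by rewrite divr_ge0// ltW.
have e2 : 0 <= e / 2 by rewrite divr_ge0// ltW.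
rewrite root_leP// (le_trans (CP n))//.
have -> : e / 2 = 2 * (e / 4) :> R by field.
rewrite (exprMn n 2) ler_wpM2r ?exprn_ge0// (le_trans CN)// -natrX ler_nat.
by rewrite (leq_trans Nn)// ltnW// ltn_expl.
Qed.

End RootTest.

Section Iterates.
Context {R : realType} {X : normedModType R[i]}.
Implicit Type T : bop X X.

Lemma iter_bounded T n : (iter n T : X -> X) \in bounded_linear.
Proof.
elim: n => [|n IH].
  by apply: bounded_linearP => [k x y //|]; exists 1 => x; rewrite mul1r.
apply: bounded_linearP => [k x y|].
  by have /= -> := bop_linear (Bop IH) k x y; exact: bop_linear.
exists (opnorm T * opnorm (Bop IH)) => x /=; rewrite -mulrA.
rewrite (le_trans (nrm_le_opnorm T _))// ler_wpM2l ?opnorm_ge0//.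
exact: (nrm_le_opnorm (Bop IH) x).
Qed.

(** The iterates of [T] with their structure of bounded operators; the underlying
function is [iter n T] by conversion. *)
Definition iterb T n : bop X X := Bop (iter_bounded T n).

Lemma iter_bopD T n x y : iter n T (x + y) = iter n T x + iter n T y.
Proof. exact: (linearD (iterb T n)). Qed.

Lemma iter_bopB T n x y : iter n T (x - y) = iter n T x - iter n T y.
Proof. exact: (linearB (iterb T n)). Qed.

Lemma iter_bopZ T n (k : R[i]) x : iter n T (k *: x) = k *: iter n T x.
Proof. exact: (linearZZ (iterb T n)). Qed.

Lemma iter_bopN T n x : iter n T (- x) = - iter n T x.
Proof. exact: (linearN (iterb T n)). Qed.

Lemma iter_bop0 T n : iter n T 0 = 0.
Proof. exact: (linear0 (iterb T n)). Qed.

Lemma iter_invariant T (M : set X) n x : Defs.invariant T M -> M x -> M (iter n T x).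
Proof. by move=> TM Mx; elim: n => //= n Mn; apply: TM; exists (iter n T x). Qed.

Lemma iter_restriction T (M : closed_subspace X) (TM : Defs.invariant T M) n x :
  cs_val (iter n (restriction TM) x) = iter n T (cs_val x).
Proof. by elim: n => //= n ->. Qed.

End Iterates.

Section Quasinilpotent.
Context {R : realType} {X : completeNormedModType R[i]} (T : bop X X).

Lemma quasinilpotent_partP x : quasinilpotent_part T x <->
  forall e : R, 0 < e -> exists C : R, forall n, nrm (iter n T x) <= C * e ^+ n.
Proof. by apply: root_cvg0P => n; exact: nrm_ge0. Qed.

(** Quasinilpotence of the restriction of [T] to [N], in terms of [T] only. *)
Definition quasinilpotent_on (N : set X) := forall e : R, 0 < e ->
  exists2 C : R, 0 <= C & forall n x, N x -> nrm (iter n T x) <= C * e ^+ n * nrm x.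

Lemma quasinilpotent_restrictionP (N : closed_subspace X) (TN : Defs.invariant T N) :
  quasinilpotent (restriction TN) <-> quasinilpotent_on N.
Proof.
have op0 n : 0 <= opnorm (iter n (restriction TN)).
  exact: (opnorm_ge0 (iterb (restriction TN) n)).
rewrite /quasinilpotent root_cvg0P//; split=> qn e e0.
  have [C CP] := qn e e0; exists C.
    by rewrite -[C]mulr1 -(expr0 e); exact: le_trans (op0 0%N) (CP 0%N).
  move=> n x Nx.
  have : nrm (cs_val (iter n (restriction TN) (cs_of Nx))) <=
      opnorm (iter n (restriction TN)) * nrm x.
    exact: (nrm_le_opnorm (iterb (restriction TN) n) (cs_of Nx)).
  rewrite iter_restriction => /le_trans; apply.
  by rewrite ler_wpM2r ?nrm_ge0//; exact: CP.
have [C C0 CP] := qn e e0; exists C => n.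
apply: (@opnorm_le _ _ _ (iterb (restriction TN) n)).
  by rewrite mulr_ge0// exprn_ge0// ltW.
move=> x; have := CP n _ (cs_valP x).
by rewrite -(iter_restriction TN).
Qed.

Lemma quasinilpotent_on_sub (N : closed_subspace X) :
  quasinilpotent_on N -> N `<=` quasinilpotent_part T.
Proof.
move=> qn x Nx; apply/quasinilpotent_partP => e e0.
have [C C0 CP] := qn e e0; exists (C * nrm x) => n.
by rewrite mulrAC CP.
Qed.

(** Pointwise decay implies uniform decay. This is the uniform boundedness
principle for the operators [e ^- n T ^ n] on [N], where [K] is the set of the
points whose orbit under them stays in the unit ball. *)
Lemma sub_quasinilpotent_on (N : closed_subspace X) :
  N `<=` quasinilpotent_part T -> quasinilpotent_on N.
Proof.
move=> NH e e0.
pose K := [set x : cs_type N | forall n, nrm (iter n T (cs_val x)) <= e ^+ n].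
have en n : 0 < e ^+ n by rewrite exprn_gt0.
have [x|x Kx n|u x Ku ux n|d d0 dK] := @sigma_convex_nbhs0 _ (cs_type N) K.
- have /quasinilpotent_partP/(_ e e0)[C CP] := NH _ (cs_valP x).
  have [m Cm] := exists_natS_ge C.
  exists m => n; rewrite [iter _ _ _](iter_bopZ T n _ (cs_val x)) nrm_scaleR.
  rewrite ger0_norm ?invr_ge0// ler_pdivrMl// (le_trans (CP n))//.
  by rewrite ler_wpM2r// ltW.
- by rewrite [iter _ _ _](iter_bopN T n (cs_val x)) nrmN; exact: Kx.
- have ux' : (fun k => cs_val (series (fun n => (2^-1 ^+ n.+1)%:C *: u n) k)) @ \oo
      --> cs_val x.
    by apply/cvg_nrmP; exact: (cvg_nrmP _ x).1 ux.
  rewrite -[iter _ _ _]subr0 nrmB.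
  apply: (nrm_cvg_le (bop_cvg (iterb T n) ux')).
  apply: nearW => k; rewrite sub0r nrmN.
  set s := series _; have : nrm (iter n T (cs_val (s k)))
      <= (1 - 2^-1 ^+ k) * e ^+ n.
    elim: k => [|k IH]; first by rewrite /s series0 iter_bop0 nrm0 expr0 subrr mul0r.
    rewrite /s seriesSr -/s [iter _ _ _](iter_bopD T n (cs_val (s k)) (cs_val _)).
    rewrite (le_trans (nrmD _ _))//.
    rewrite [X in _ + nrm X](iter_bopZ T n _ (cs_val (u k))) nrm_scaleR.
    have := Ku k n; have : 0 <= 2^-1 ^+ k.+1 :> R by rewrite exprn_ge0.
    move=> h0; rewrite ger0_norm// => /(ler_wpM2l h0); move: IH.
    have -> : 2^-1 ^+ k = 2 * 2^-1 ^+ k.+1 :> R by rewrite exprS; field.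
    by move: (_ ^+ k.+1) (e ^+ n) (nrm _) (nrm _) => a b c f; nra.
  move=> /le_trans; apply; rewrite ler_piMl ?(ltW (en _))// gerBl exprn_ge0//.
exists d^-1 => [|n x Nx]; first by rewrite invr_ge0 ltW.
have [x0|x0] := eqVneq (nrm x) 0.
  by rewrite (nrm_eq0 x0) iter_bop0 nrm0 mulr0.
have xp : 0 < nrm x by rewrite lt_neqAle eq_sym x0 nrm_ge0.
have dx : 0 < d / nrm x by rewrite divr_gt0.
have := dK ((d / nrm x)%:C *: cs_of Nx); rewrite nrm_scaleR gtr0_norm//.
rewrite divfK// => /(_ (lexx _))/(_ n).
rewrite [iter _ _ _](iter_bopZ T n _ x) nrm_scaleR gtr0_norm//=.
rewrite mulrC -ler_pdivlMr// => /le_trans; apply.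
by rewrite invf_div mulrA mulrC mulrA.
Qed.

End Quasinilpotent.

(** * The analytical core and semi-regular restrictions *)

Section AnalyticalCore.
Context {R : realType} {X : completeNormedModType R[i]} (T : bop X X).
Implicit Types x y : X.

(** The constant [c] replaces the norm of [x]: the orbits of a sum or of an image
can then be bounded even when the resulting point is [0], for which the bound
in the definition of the core would leave the zero sequence only. A constant
[c] larger than the norm of [x] is absorbed into [d], since the terms of
index at least [1] are the only ones to be bounded. *)
Lemma analytical_coreP x : analytical_core T x <->
  exists (u : nat -> X) (c d : R), [/\ 0 < d, u 0%N = x, forall n, T (u n.+1) = u n &
    forall n, nrm (u n) <= c * d ^+ n].
Proof.
split=> [[u [d [d0 u1 uS ud]]]|[u [c [d [d0 u0 uS ud]]]]].
  exists (fun n => if n is 0%N then x else u n), (nrm x), d; split=> //.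
    by move=> [|n]; [|exact: uS].
  by move=> [|n]; [rewrite expr0 mulr1|rewrite mulrC; exact: ud].
have [x0|x0] := eqVneq (nrm x) 0.
  exists (fun=> 0), 1; rewrite (nrm_eq0 x0) linear0; split=> // n _.
  by rewrite nrm0 mulr0.
have xp : 0 < nrm x by rewrite lt_neqAle eq_sym x0 nrm_ge0.
pose m := Num.max 1 (c / nrm x).
have m1 : 1 <= m by rewrite le_max lexx.
have mc : c <= m * nrm x by rewrite -ler_pdivrMr// le_max lexx orbT.
exists u, (d * m); split=> //; first by rewrite mulr_gt0// (lt_le_trans ltr01).
  by rewrite uS.
move=> [//|n] _; rewrite (le_trans (ud _))// exprMn mulrC -mulrA.
rewrite ler_wpM2l ?exprn_ge0 ?(ltW d0)// (le_trans mc)// ler_wpM2r ?nrm_ge0//.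
by rewrite ler_eXnr.
Qed.

Lemma analytical_core0 : analytical_core T 0.
Proof.
apply/analytical_coreP; exists (fun=> 0), 0, 1; split=> // n; first exact: linear0.
by rewrite nrm0 mul0r.
Qed.

Lemma analytical_coreDZ (k : R[i]) x y :
  analytical_core T x -> analytical_core T y -> analytical_core T (k *: x + y).
Proof.
move=> /analytical_coreP[u [c [d [d0 u0 uS ud]]]].
move=> /analytical_coreP[v [c' [d' [d0' v0 vS vd]]]].
have cp (w : nat -> X) (a b : R) : (forall n, nrm (w n) <= a * b ^+ n) -> 0 <= a.
  by move=> /(_ 0%N); rewrite expr0 mulr1; exact/le_trans/nrm_ge0.
have c0 := cp _ _ _ ud; have c0' := cp _ _ _ vd.
apply/analytical_coreP; exists (fun n => k *: u n + v n).
exists (nrm (k : R[i]^o) * c + c'), (Num.max d d'); split=> [||n|n].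
- by rewrite lt_max d0.
- by rewrite u0 v0.
- by rewrite bop_linear uS vS.
- rewrite (le_trans (nrmD _ _))// mulrDl lerD//.
    rewrite nrm_scale -mulrA ler_wpM2l ?nrm_ge0// (le_trans (ud _))// ler_wpM2l//.
    by rewrite lerXn2r ?nnegrE ?le_max ?(ltW d0) ?lexx.
  rewrite (le_trans (vd _))// ler_wpM2l//.
  by rewrite lerXn2r ?nnegrE ?le_max ?(ltW d0) ?(ltW d0') ?lexx ?orbT.
Qed.

Lemma analytical_core_preimage x : analytical_core T x ->
  exists2 y, analytical_core T y & T y = x.
Proof.
move=> /analytical_coreP[u [c [d [d0 u0 uS ud]]]]; exists (u 1%N); last by rewrite uS.
apply/analytical_coreP; exists (fun n => u n.+1), (c * d), d; split=> // n.
by rewrite -mulrA -exprS.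
Qed.

Lemma analytical_core_image x : analytical_core T x -> analytical_core T (T x).
Proof.
move=> /analytical_coreP[u [c [d [d0 u0 uS ud]]]].
apply/analytical_coreP; exists (fun n => T (u n)), (opnorm T * c), d; split=> //.
- by rewrite u0.
- by move=> n; rewrite uS.
- move=> n; rewrite (le_trans (nrm_le_opnorm T _))// -mulrA.
  by rewrite ler_wpM2l ?opnorm_ge0.
Qed.

(** Iterating a bounded choice of preimages; the ratio [C] is uniform over [M]. *)
Lemma backward_orbits (M : closed_subspace X) : T @` M = M ->
  exists2 C : R, 0 < C & forall x, cs_set M x -> exists u : nat -> X,
    [/\ u 0%N = x, forall n, T (u n.+1) = u n & forall n, nrm (u n) <= nrm x * C ^+ n].
Proof.
move=> TM; have [|C C0 CP] := @closed_range_lift _ _ T M.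
  by rewrite TM; exact: cs_closed.
exists C => // x Mx.
have H y : exists z, cs_set M y -> [/\ cs_set M z, T z = y & nrm z <= C * nrm y].
  have [My|] := pselect (cs_set M y); last by exists 0.
  have : (T @` M) y by rewrite TM.
  case=> z0 Mz0 z0y; have [z [Mz Tz zC]] := CP z0 Mz0.
  by exists z => _; rewrite -z0y.
have [f fP] := choice H.
have MP n : cs_set M (iter n f x) by elim: n => //= n /fP[].
exists (fun n => iter n f x); split=> //= n; first by have [] := fP _ (MP n).
elim: n => [|n IH]; first by rewrite expr0 mulr1.
have [_ _ /le_trans] := fP _ (MP n); apply.
by rewrite exprS mulrCA ler_pM2l.
Qed.

Lemma sub_analytical_core (M : closed_subspace X) : T @` M = M ->
  M `<=` analytical_core T.
Proof.
move=> /backward_orbits[C C0 CP] x /CP[u [u0 uS uC]].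
by apply/analytical_coreP; exists u, (nrm x), C.
Qed.

End AnalyticalCore.

Section Kato.
Context {R : realType} {X : completeNormedModType R[i]} (T : bop X X).

(** The condition on null spaces in the semi-regularity of the restriction of [T]
to [M]. *)
Definition hereditary_null (M : set X) := forall n x, M x -> iter n T x = 0 -> (T @` M) x.

Lemma restriction_range (M : closed_subspace X) (TM : Defs.invariant T M)
    (x : cs_type M) :
  range (restriction TM) x <-> (T @` M) (cs_val x).
Proof.
split=> [[y _ <-]|[y My yx]]; first by exists (cs_val y) => //; exact: cs_valP.
by exists (cs_of My) => //; exact: val_inj.
Qed.

Lemma restriction_semi_regularP (M : closed_subspace X) (TM : Defs.invariant T M) :
  semi_regular (restriction TM) <-> closed (T @` M) /\ hereditary_null M.
Proof.
split=> [[Rcl Rnull]|[Wcl Wnull]]; split.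
- apply/closed_nrmP => x xW.
  have Mx : cs_set M x.
    apply: (closed_nrmP M).1; first exact: cs_closed.
    by move=> e /xW[y /TM My xy]; exists y.
  apply/(restriction_range TM (cs_of Mx))/(closed_nrmP _).1 => // e.
  move=> /xW[_ [y My <-] xy].
  by exists (restriction TM (cs_of My)) => //; exists (cs_of My).
- move=> n x Mx Tx0; apply/(restriction_range TM (cs_of Mx))/(Rnull n) => /=.
  have Sx0 : cs_val (iter n (restriction TM) (cs_of Mx)) = 0.
    by rewrite iter_restriction.
  exact: (@val_inj _ _ (cs_type M) _ 0 Sx0).
- apply/closed_nrmP => x xW; apply/restriction_range.
  apply: (closed_nrmP _).1 Wcl _ _ => e /xW[y /restriction_range Wy xy].
  by exists (cs_val y).
- move=> n x /= Sx0; apply/restriction_range/(Wnull n); first exact: cs_valP.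
  by rewrite -(iter_restriction TM) Sx0.
Qed.

Lemma restriction_surjP (M : closed_subspace X) (TM : Defs.invariant T M) :
  set_surj setT setT (restriction TM) <-> T @` M = M.
Proof.
split=> [surj|TME x _]; last first.
  by apply/restriction_range; rewrite TME; exact: cs_valP.
apply/seteqP; split; first exact: TM.
by move=> x Mx; apply/(restriction_range TM (cs_of Mx))/surj.
Qed.

Variable M : closed_subspace X.
Hypothesis TM : Defs.invariant T M.
Hypotheses (Wcl : closed (T @` M)) (Wnull : hereditary_null M).

(** Lifting [T ^ n x] back one step at a time. After [k] steps, the lift [z] and
[T ^ (n - k) x] have the same image under [T ^ k], so they differ by an element
of a null space, which lies in the range; hence [z] is in the range as well,
and can be lifted again at the cost of a factor [C]. *)
Lemma iterated_lift : exists2 C : R, 0 < C & forall n k x, cs_set M x -> (k <= n)%N ->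
  exists z, [/\ cs_set M z, iter k T z = iter n T x & nrm z <= C ^+ k * nrm (iter n T x)].
Proof.
have [C C0 CP] := closed_range_lift Wcl; exists C => // n k x Mx.
have Mn j : cs_set M (iter j T x) by exact: iter_invariant.
elim: k => [_|k IH kn]; first by exists (iter n T x); rewrite expr0 mul1r.
have [z [Mz zE zC]] := IH (ltnW kn).
have [v Mv vz] : (T @` M) z.
  have [y My yE] : (T @` M) (iter (n - k) T x - z).
    apply: (Wnull (n := k)); first exact: csB.
    by rewrite iter_bopB zE -iterD subnKC ?subrr// ltnW.
  exists (iter (n - k).-1 T x - y); first exact: csB.
  rewrite linearB/= yE -iterS prednK ?subn_gt0//.
  by rewrite opprB addrC subrK.
have [w [Mw wE wC]] := CP v Mv; exists w; split=> //.
  by rewrite iterSr wE vz.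
rewrite (le_trans wC)// vz exprS -mulrA ler_pM2l//.
Qed.

(** If [z] is the [n]-fold lift of [T ^ n x], then [x - z] lies in the null space
of [T ^ n], hence in the range, and [z] is at most [C ^ n] times [T ^ n x],
which tends to [0]. So [x] is a limit of points of the closed range. *)
Lemma quasinilpotent_part_sub_range x : cs_set M x -> quasinilpotent_part T x ->
  (T @` M) x.
Proof.
move=> Mx /quasinilpotent_partP qx; have [C C0 CP] := iterated_lift.
have [|D DP] := qx (2^-1 / C); first by rewrite divr_gt0// invr_gt0.
apply/(closed_nrmP (T @` M)).1 => // e e0.
have : geometric D 2^-1 @ \oo --> (0 : R).
  by apply: cvg_geometric; rewrite ger0_norm// invf_lt1// ltr1n.
move=> /cvgrPdist_lt/(_ _ e0)[n _ /(_ n (leqnn n))] /=.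
rewrite sub0r normrN => /(le_lt_trans (ler_norm _)) nD.
have [z [Mz zE zC]] := CP n n x Mx (leqnn n).
exists (x - z); last first.
  rewrite subKr (le_lt_trans zC)// (le_lt_trans _ nD)//.
  have Cn : 0 <= C ^+ n by rewrite exprn_ge0// ltW.
  rewrite (le_trans (ler_wpM2l Cn (DP n)))// exprMn.
  have -> : C ^+ n * (D * (2^-1 ^+ n * C^-1 ^+ n)) = D * 2^-1 ^+ n * (C^-1 ^+ n * C ^+ n).
    by ring.
  by rewrite -exprMn mulVf ?gt_eqF// expr1n mulr1.
by apply: (Wnull (n := n)); rewrite ?iter_bopB ?zE ?subrr//; exact: csB.
Qed.

Variable N : closed_subspace X.
Hypothesis TN : Defs.invariant T N.
Hypotheses (MN : direct_sum M N) (Nq : quasinilpotent_on T N).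

(** The component [n] of [x] along [N] equals [T ^ k] applied to the component of
[u k], for every [k]. The backward orbit [u] grows at most geometrically while
[T] is quasinilpotent on [N], so [n] vanishes. *)
Lemma analytical_core_sub : analytical_core T `<=` M.
Proof.
move=> x /analytical_coreP[u [c [d [d0 u0 uS ud]]]].
have [P P0 PP] : exists2 P : R, 0 < P &
    forall m n, cs_set M m -> cs_set N n -> nrm n <= P * nrm (m + n).
  have [|P P0 PP] := @direct_sum_bounded_projection _ _ N M.
    exact: direct_sum_sym.
  by exists P => // m n Mm Nn; rewrite addrC; exact: PP.
(* A decay rate that beats the growth rate [d] of the orbit by a factor two. *)
have [|D D0 DP] := Nq (e := 2^-1 / d); first by rewrite divr_gt0// invr_gt0.
have [m [n [Mm Nn xE]]] := direct_sum_decomp x MN.1.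
have uE k : iter k T (u k) = x.
  by elim: k => // k IH; rewrite iterSr uS.
suff n0 : n = 0 by rewrite xE n0 addr0.
have nk k : nrm n <= D * P * c * 2^-1 ^+ k.
  have [mk [nk [Mmk Nnk ukE]]] := direct_sum_decomp (u k) MN.1.
  have [_ ->] : m = iter k T mk /\ n = iter k T nk.
    apply: (direct_sum_uniq MN) => //; try exact: iter_invariant.
    by rewrite -xE -iter_bopD -ukE uE.
  rewrite (le_trans (DP k nk Nnk))//.
  have := PP mk nk Mmk Nnk; rewrite -ukE => /le_trans/(_ (ler_wpM2l (ltW P0) (ud k))).
  rewrite mulrA => PP'.
  have Dk : 0 <= D * (2^-1 / d) ^+ k.
    by rewrite mulr_ge0// exprn_ge0// ltW// divr_gt0// invr_gt0.
  rewrite (le_trans (ler_wpM2l Dk PP'))// exprMn.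
  have -> : D * (2^-1 ^+ k * (d^-1) ^+ k) * (P * c * d ^+ k) =
      D * P * c * 2^-1 ^+ k * ((d^-1) ^+ k * d ^+ k) by ring.
  by rewrite -exprMn mulVf ?gt_eqF// expr1n mulr1.
apply/nrm_eq0/eqP; rewrite eq_le nrm_ge0 andbT.
by apply: le_geometric_le0 nk; rewrite ?invr_ge0// invf_lt1// ltr1n.
Qed.

(** The core lies in [T @` M], and so does the component along [M] of any point of
the quasinilpotent part. Projecting onto [M] a point close to [x] in [M] then
gives a point of the closed set [T @` M] close to [x]. *)
Lemma dense_core_surj :
  dense (set_sum (analytical_core T) (quasinilpotent_part T)) -> T @` M = M.
Proof.
move=> dns; apply/seteqP; split; first exact: TM.
have [P P0 PP] := direct_sum_bounded_projection MN.
have H0W h : quasinilpotent_part T h ->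
    exists w n, [/\ (T @` M) w, cs_set N n & h = w + n].
  move=> /quasinilpotent_partP hq.
  have [m [n [Mm Nn hE]]] := direct_sum_decomp h MN.1.
  exists m, n; split=> //; apply: quasinilpotent_part_sub_range => //.
  apply/quasinilpotent_partP => e e0; have [C CP] := hq e e0.
  exists (P * C) => k; rewrite -mulrA.
  have Mk : cs_set M (iter k T m) by exact: iter_invariant.
  have Nk : cs_set N (iter k T n) by exact: iter_invariant.
  rewrite (le_trans (PP _ _ Mk Nk))// -iter_bopD -hE ler_pM2l//.
move=> x Mx; apply/(closed_nrmP (T @` M)).1 => // e e0.
have eP : 0 < e / P by rewrite divr_gt0.
have [y [xy [k Kk [h Hh khE]]]] : exists y,
    nrm (x - y) < e / P /\ set_sum (analytical_core T) (quasinilpotent_part T) y.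
  pose B := [set y | nrm (x - y) < e / P].
  have Bx : nbhs x B by apply/nbhs_nrmP; exists (e / P).
  have [|y [/interior_subset By Sy]] := dns B^° _ (open_interior B); first by exists x.
  by exists y.
have [w [n [[w' Mw' w'E] Nn hE]]] := H0W h Hh.
have [k' Kk' k'E] := analytical_core_preimage Kk.
exists (k + w).
  exists (k' + w'); last by rewrite -k'E -w'E; exact: (linearD T).
  by apply: csD => //; exact: analytical_core_sub.
have Wkw : cs_set M (k + w).
  apply: csD; first exact: analytical_core_sub.
  by rewrite -w'E; apply: TM; exists w'.
rewrite (le_lt_trans (PP _ (- n) (csB Mx Wkw) (csN Nn)))// -ltr_pdivlMl//.
rewrite mulrC (_ : x - (k + w) - n = x - y)//.
by rewrite -khE hE (addrA k) [in RHS]opprD [in RHS]addrA.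
Qed.

End Kato.

(** * The Hahn-Banach theorem *)

Section RealHahnBanach.
Context {R : realType} {X : normedModType R[i]} (C : R).
Hypothesis C0 : 0 <= C.

(** Partial real-linear functionals are represented by their graphs, so that
extension is inclusion and the union of a chain needs no gluing. *)
Definition dominated_graph (G : set (X * R)) :=
  (forall (t : R) p q, G p -> G q -> G (t%:C *: p.1 + q.1, t * p.2 + q.2)) /\
  (forall p, G p -> p.2 <= C * nrm p.1).

Lemma dominated_graphZ G (t : R) p : dominated_graph G -> G (0, 0) -> G p ->
  G (t%:C *: p.1, t * p.2).
Proof. by move=> [Gl _] G0 /Gl/(_ G0); move=> /(_ t); rewrite !addr0. Qed.

Lemma dominated_graph_fun G x a b : dominated_graph G ->
  G (x, a) -> G (x, b) -> a = b.
Proof.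
move=> [Gl Gd] Ga Gb; apply/eqP; rewrite eq_le.
have H c d : G (x, c) -> G (x, d) -> c <= d.
  move=> Gc Gd'; have := Gd _ (Gl (-1) _ _ Gd' Gc) => /=.
  by rewrite rmorphN rmorph1 scaleN1r addNr nrm0 mulr0 mulN1r addrC subr_le0.
by rewrite !H.
Qed.

(** One-step extension. The value [s] at [x0] has to lie above every
[p.2 - C * nrm (p.1 - x0)] and below every [C * nrm (p.1 + x0) - p.2], which is
possible by the triangle inequality. *)
Lemma dominated_graph_extend G x0 : dominated_graph G -> G (0, 0) ->
  exists s : R, dominated_graph
    [set q | exists p (t : R), G p /\ q = (p.1 + t%:C *: x0, p.2 + t * s)].
Proof.
move=> GP G0; have [Gl Gd] := GP.
pose S := [set p.2 - C * nrm (p.1 - x0) | p in G].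
have SU p q : G p -> G q -> p.2 - C * nrm (p.1 - x0) <= C * nrm (q.1 + x0) - q.2.
  move=> Gp Gq; have := Gd _ (Gl 1 _ _ Gp Gq); rewrite /= rmorph1 scale1r mul1r.
  have -> : p.1 + q.1 = (p.1 - x0) + (q.1 + x0).
    by rewrite addrACA addNr addr0.
  have := ler_wpM2l C0 (nrmD (p.1 - x0) (q.1 + x0)).
  by rewrite mulrDr; lra.
have Ssup : has_sup S.
  split; first by exists (0 - C * nrm (0 - x0)), (0, 0).
  by exists (C * nrm (0 + x0) - 0) => _ [p Gp <-]; exact: (SU p (0, 0)).
exists (sup S); split.
  move=> t _ _ [p [a [Gp ->]]] [q [b [Gq ->]]] /=.
  exists (t%:C *: p.1 + q.1, t * p.2 + q.2), (t * a + b); split; first exact: Gl.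
  congr (_, _); last by rewrite /=; ring.
  rewrite /= scalerDr scalerA addrACA; congr (_ + _).
  by rewrite -scalerDl -rmorphM -rmorphD.
have sl p : G p -> p.2 - C * nrm (p.1 - x0) <= sup S.
  by move=> Gp; apply: sup_upper_bound => //; exists p.
have su p : G p -> sup S <= C * nrm (p.1 + x0) - p.2.
  by move=> Gp; apply: ge_sup; [case: Ssup|move=> _ [q Gq <-]; exact: SU].
move=> _ [p [t [Gp ->]]] /=.
have [t0|t0|->] := ltgtP t 0; last first.
- by rewrite mul0r addr0 rmorph0 scale0r addr0; exact: Gd.
- have /su /= := dominated_graphZ t^-1 GP G0 Gp.
  have -> : p.1 + t%:C *: x0 = t%:C *: (t^-1%:C *: p.1 + x0).
    by rewrite scalerDr scalerA -rmorphM mulfV ?gt_eqF// rmorph1 scale1r.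
  rewrite nrm_scaleR gtr0_norm// => /(ler_wpM2l (ltW t0)).
  rewrite mulrBr mulVKf ?gt_eqF// => H.
  by rewrite -lerBrDl mulrCA.
- have /sl /= := dominated_graphZ (- t)^-1 GP G0 Gp.
  have nt0 : 0 < - t by rewrite oppr_gt0.
  have -> : p.1 + t%:C *: x0 = (- t)%:C *: ((- t)^-1%:C *: p.1 - x0).
    rewrite scalerBr scalerA -rmorphM mulfV ?gt_eqF// rmorph1 scale1r.
    by rewrite rmorphN scaleNr opprK.
  rewrite nrm_scaleR gtr0_norm// => /(ler_wpM2l (ltW nt0)).
  rewrite mulrBr mulVKf ?gt_eqF// => H.
  by move: H; rewrite mulrCA mulNr; lra.
Qed.

(** The graph is extended as long as possible by Zorn's lemma; a maximal graph is
total by the one-step extension. *)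
Lemma hahn_banach_real (G0 : set (X * R)) : dominated_graph G0 -> G0 (0, 0) ->
  exists f : X -> R, [/\ forall (t : R) x y, f (t%:C *: x + y) = t * f x + f y,
    forall x, f x <= C * nrm x & forall x a, G0 (x, a) -> f x = a].
Proof.
move=> G0P G00.
(* The sets compared are joined with [G0], so that the empty chain has an
   upper bound. *)
have [F FP Ftot|A [AP Amax]] := @Zorn_bigcup _ [set A | dominated_graph (G0 `|` A)].
  have [->|/set0P[A0 FA0]] := eqVneq F set0; first by rewrite bigcup_set0 /= setU0.
  have pick p : (G0 `|` \bigcup_(A in F) A) p -> exists2 A, F A & (G0 `|` A) p.
    by move=> [Gp|[A FA Ap]]; [exists A0 => //; left|exists A => //; right].
  split=> [t p q /pick[A FA Ap] /pick[B FB Bq]|p /pick[A FA Ap]]; last first.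
    exact: (FP A FA).2.
  have [D [FD Dp Dq]] : exists D, [/\ F D, (G0 `|` D) p & (G0 `|` D) q].
    by have [AB|BA] := Ftot _ _ FA FB; [exists B|exists A]; split=> //;
      [move: Ap; exact: setUS|move: Bq; exact: setUS].
  have [] := (FP D FD).1 t p q Dp Dq; first by left.
  by right; exists D.
set G := G0 `|` A in AP.
have GG0 : G (0, 0) by left.
have Gtot x : exists a, G (x, a).
  apply: contrapT => Gx; have [s sP] := dominated_graph_extend x AP GG0.
  set G' := [set q | _] in sP.
  have GG' : G `<=` G'.
    by move=> [y b] Gy; exists (y, b), 0; rewrite rmorph0 scale0r mul0r !addr0.
  apply: (Amax G'); last first.
    by rewrite /= setUidr//; apply: subset_trans GG' => p; left.
  split; first by move=> p Ap; apply: GG'; right.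
  move=> /(_ (x, s)) G'A; apply: Gx; exists s; right; apply: G'A.
  by exists (0, 0), 1; rewrite rmorph1 scale1r mul1r !add0r.
have [f fP] := choice Gtot.
exists f; split=> [t x y|x|x a Ga].
- by apply: (dominated_graph_fun AP (fP _)); exact: (AP.1 t _ _ (fP x) (fP y)).
- exact: (AP.2 _ (fP x)).
- by apply: (dominated_graph_fun AP (fP _)); left.
Qed.

End RealHahnBanach.

Section HahnBanach.
Context {R : realType} {X : normedModType R[i]}.

Lemma complex_real_imag (k : R[i]) (x : X) :
  k *: x = (complex.Re k)%:C *: x + (complex.Im k)%:C *: ('i%C *: x).
Proof.
rewrite scalerA -scalerDl; congr (_ *: _).
by rewrite {1}[k]complexE mulrC.
Qed.

Lemma nrm_sqr (z : R[i]) : nrm (z : R[i]^o) ^+ 2 = complex.Re (z * conjc z).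
Proof.
case: z => a b; rewrite /nrm normc_def /= sqr_sqrtr ?addr_ge0 ?sqr_ge0//.
by ring.
Qed.

Lemma nrm_conjc (z : R[i]) : nrm (conjc z : R[i]^o) = nrm (z : R[i]^o).
Proof. by case: z => a b; rewrite /nrm !normc_def /= sqrrN. Qed.

Lemma Re_le_nrm (z : R[i]) : complex.Re z <= nrm (z : R[i]^o).
Proof.
rewrite -lecR -(@nrmE R R[i]^o); apply: le_trans (normc_ge_Re z).
by rewrite lecR ler_norm.
Qed.

(** The complex functional is recovered from the extension [f] of the real part by
[F x = f x - i f (i x)]. To bound it at [x], multiply [x] by the conjugate of
[F x]: the value becomes real, hence is a value of [f]. Posing the problem on a
graph lets the initial functional be given by any linear parametrization of
its domain. *)
Lemma hahn_banach_graph (G : X -> R[i] -> Prop) (C : R) : 0 <= C -> G 0 0 ->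
    (forall k x y c d, G x c -> G y d -> G (k *: x + y) (k * c + d)) ->
    (forall x c, G x c -> nrm (c : R[i]^o) <= C * nrm x) ->
  exists2 F : dual_space X, forall x c, G x c -> F x = c &
    forall x, nrm (F x) <= C * nrm x.
Proof.
move=> C0 G00 Glin GC.
pose G0 := [set p : X * R | exists2 c, G p.1 c & p.2 = complex.Re c].
have [||f [fl fC fG]] := @hahn_banach_real R X C C0 G0.
- split=> [t [x a] [y b] [c /= Gc ->] [d /= Gd ->]|[x a] [c /= Gc ->]].
    exists (t%:C * c + d); first exact: Glin.
    by rewrite raddfD/=; case: (c) => c1 c2 /=; rewrite mul0r subr0.
  exact: le_trans (Re_le_nrm c) (GC x c Gc).
- by exists 0.
have fD x y : f (x + y) = f x + f y by have := fl 1 x y; rewrite rmorph1 scale1r mul1r.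
have f0 : f 0 = 0 by apply: (addrI (f 0)); rewrite -fD !addr0.
have fZ (t : R) x : f (t%:C *: x) = t * f x by have := fl t x 0; rewrite !addr0 f0 addr0.
pose F x : R[i]^o := f x +i* - f ('i%C *: x).
have fk (k : R[i]) x : f (k *: x) = complex.Re k * f x + complex.Im k * f ('i%C *: x).
  by rewrite complex_real_imag fD !fZ.
have Flin : linear F.
  move=> k x y; rewrite /F !fD (fk k x) scalerDr fD scalerA (fk ('i%C * k) x).
  case: k => a b; apply/eqP; rewrite eq_complex /=; apply/andP.
  by split; apply/eqP; ring.
have FC x : nrm (F x) <= C * nrm x.
  have [z0|z0] := eqVneq (nrm (F x)) 0; first by rewrite z0 mulr_ge0 ?nrm_ge0.
  have zp : 0 < nrm (F x) by rewrite lt_neqAle eq_sym z0 nrm_ge0.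
  have := fC (conjc (F x) *: x); rewrite nrm_scale nrm_conjc mulrCA.
  have -> : f (conjc (F x) *: x) = nrm (F x) ^+ 2.
    by rewrite nrm_sqr fk /F /=; ring.
  by rewrite expr2 ler_pM2l.
have FB : F \in bounded_linear by apply: bounded_linearP => //; exists C.
exists (Bop FB) => // x c Gc /=.
have Gic : G ('i%C *: x) ('i%C * c) by have := Glin 'i%C _ _ _ _ Gc G00; rewrite !addr0.
rewrite /F (fG x (complex.Re c)); last by exists c.
rewrite (fG ('i%C *: x) (complex.Re ('i%C * c))); last by exists ('i%C * c).
by case: (c) => a b /=; rewrite mul0r mul1r sub0r opprK.
Qed.

End HahnBanach.

(** * Zeros of vector-valued analytic functions *)

Section ScalarNorm.
Context {R : realType}.
Implicit Types z w : R[i].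

Lemma nrmX z n : nrm (z ^+ n : R[i]^o) = nrm (z : R[i]^o) ^+ n.
Proof.
elim: n => [|n IH]; last by rewrite !exprS nrmM IH.
by rewrite !expr0 /nrm normr1.
Qed.

Lemma nrm_mulrn (X : normedModType R[i]) (x : X) n : nrm (x *+ n) = nrm x *+ n.
Proof.
rewrite -scaler_nat nrm_scale -(rmorph_nat (real_complex R)) nrmC normr_nat.
by rewrite mulr_natl.
Qed.

Lemma nrm_sum_nat (X : normedModType R[i]) m n (u : nat -> X) :
  nrm (\sum_(m <= k < n) u k) <= \sum_(m <= k < n) nrm (u k).
Proof.
elim/big_ind2: _ => //; first by rewrite nrm0.
by move=> x a y b xa yb; rewrite (le_trans (nrmD _ _))// lerD.
Qed.

Lemma connected_disc (r : R) : connected [set z : R[i]^o | nrm z < r].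
Proof.
set D := [set z | _].
have -> : D = \bigcup_(z in D) ((fun t : R => (t%:C * z : R[i]^o)) @` `[0, 1]).
  apply/seteqP; split=> [z Dz|_ [z Dz [t /= t01 <-]]].
    exists z => //; exists 1; rewrite ?rmorph1 ?mul1r//=.
    by rewrite in_itv /= ler01 lexx.
  move: t01; rewrite in_itv /= => /andP[t0 t1].
  rewrite /D /= nrmM nrmC ger0_norm//; apply: le_lt_trans Dz.
  by rewrite ler_piMl ?nrm_ge0.
apply: bigcup_connected.
  exists 0 => z Dz /=; exists 0; first by rewrite /= in_itv /= lexx ler01.
  by rewrite rmorph0 mul0r.
move=> z Dz; apply: connected_continuous_connected; first exact: segment_connected.
apply: continuous_subspaceT => t; apply/cvgrPdist_lt => _ /real_complex_gt0[e e0 ->].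
have zp : 0 < 1 + nrm z by rewrite ltr_wpDr ?nrm_ge0.
have : \forall s \near t, `|t - s| < e / (1 + nrm z).
  by apply: (@cvgr_dist_lt _ _ _ (nbhs t) _ idfun t) => //; rewrite divr_gt0.
apply: filterS => s ts; rewrite nrmE ltcR -mulrBl -rmorphB nrmM nrmC.
rewrite (le_lt_trans (y := `|t - s| * (1 + nrm z)))//; last by rewrite -ltr_pdivlMr.
by rewrite ler_wpM2l// lerDr.
Qed.

End ScalarNorm.

Section PowerSeries.
Context {R : realType} {Y : completeNormedModType R[i]}.
Implicit Types (a : nat -> Y) (z : R[i]).

Lemma cvg_seq_bounded (u : nat -> Y) (l : Y) : u @ \oo --> l ->
  exists B : R, forall n, nrm (u n) <= B.
Proof.
move=> /cvg_nrmP/cvgrPdist_lt/(_ 1 ltr01)[N _ NP].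
exists (1 + nrm l + \sum_(k < N) nrm (u k)) => n.
have S0 (k : 'I_N) : 0 <= nrm (u k) by exact: nrm_ge0.
have [nN|Nn] := ltnP n N.
  rewrite (bigD1 (Ordinal nN))//= addrCA lerDl addr_ge0 ?addr_ge0 ?nrm_ge0//.
  by rewrite sumr_ge0.
have := NP n Nn; rewrite /= sub0r normrN ger0_norm ?nrm_ge0// => /ltW lu.
rewrite (@le_trans _ _ (1 + nrm l))//; last by rewrite lerDl sumr_ge0.
by rewrite -[u n](subrK l) (le_trans (nrmD _ _))// lerD2r nrmB.
Qed.

(** If the coefficients before [a n] vanish, then at a zero [z] at distance [t]
from [z0] the term of index [n] is minus the tail of the series, which is
[O(t ^ n.+1)]. Letting [t] tend to [0] along the zeros gives [a n = 0]. *)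
Lemma power_series_zeros (f : R[i]^o -> Y) (z0 : R[i]^o) a :
    (\forall z \near z0, series (fun n => (z - z0) ^+ n *: a n) @ \oo --> f z) ->
    (forall e : R, 0 < e -> exists z : R[i]^o,
      [/\ 0 < nrm (z - z0), nrm (z - z0) < e & f z = 0]) ->
  \forall z \near z0, f z = 0.
Proof.
move=> /nbhs_nrmP[e0 e00 fE] fz.
pose r := e0 / 2; have r0 : 0 < r by rewrite divr_gt0.
have re0 : r < e0 by rewrite ltr_pdivrMr// ltr_pMr// ltr1n.
(* The terms of a series that converges at distance [r] are bounded. *)
have [B BP] : exists B : R, forall n, nrm (a n) * r ^+ n <= B.
  have [|B BP] := @cvg_seq_bounded (series (fun n => (r%:C) ^+ n *: a n)) (f (z0 + r%:C)).
    have := fE (z0 + r%:C); rewrite opprD addNKr nrmN nrmC gtr0_norm// => /(_ re0).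
    by rewrite addrAC subrr add0r.
  exists (B + B) => n; rewrite mulrC -{1}(gtr0_norm r0) -nrmC -nrmX -nrm_scale.
  rewrite (_ : _ *: _ = series (fun n => (r%:C) ^+ n *: a n) n.+1 -
    series (fun n => (r%:C) ^+ n *: a n) n).
    by rewrite (le_trans (nrmD _ _))// nrmN lerD.
  by rewrite seriesSr addrAC subrr add0r.
have B0 : 0 <= B by rewrite (le_trans _ (BP 0%N))// mulr_ge0 ?nrm_ge0 ?exprn_ge0// ltW.
have aE k : nrm (a k) <= B * r^-1 ^+ k by rewrite exprVn ler_pdivlMr ?exprn_gt0.
have a0 n : a n = 0.
  have [m] := ubnP n; elim: m n => // m IH n /ltnSE nm.
  have {}IH k : (k < n)%N -> a k = 0 by move=> kn; apply: IH; exact: leq_trans nm.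
  apply/nrm_eq0/eqP; rewrite eq_le nrm_ge0 andbT.
  pose D := 2 * B * r^-1 ^+ n.+1.
  have D0 : 0 <= D by rewrite !mulr_ge0// exprn_ge0// invr_ge0 ltW.
  apply/ler_addgt0Pr => e ee0; rewrite add0r.
  have [|z [zp ze fz0]] := fz (Num.min (e / (D + 1)) (r / 2)).
    by rewrite lt_min !divr_gt0// ltr_wpDl.
  move: ze; rewrite lt_min => /andP[ze zr].
  set t := nrm _ in zp ze zr.
  have q0 : 0 <= t / r by rewrite divr_ge0// ltW.
  have q1 : t / r <= 2^-1 by rewrite ler_pdivrMr// mulrC ltW.
  have q1' : t / r < 1 by rewrite (le_lt_trans q1)// invf_lt1// ltr1n.
  have key : nrm ((z - z0) ^+ n *: a n - 0) <= B * ((t / r) ^+ n.+1 / (1 - t / r)).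
    rewrite -fz0; apply: (nrm_cvg_le (u := series (fun n => (z - z0) ^+ n *: a n))).
      apply: fE; rewrite nrmB (lt_trans zr)// (lt_trans _ re0)//.
      by rewrite ltr_pdivrMr// ltr_pMr// ltr1n.
    exists n.+1 => // N /= nN; rewrite nrmB.
    have -> : (z - z0) ^+ n *: a n = series (fun n => (z - z0) ^+ n *: a n) n.+1.
      rewrite seriesSr /series /= big_nat big1 ?add0r// => k /andP[_ kn].
      by rewrite IH// scaler0.
    rewrite sub_series_geq// (le_trans (nrm_sum_nat _ _ _))//.
    rewrite (@le_trans _ _ (\sum_(n.+1 <= k < N) B * (t / r) ^+ k))//.
      rewrite ler_sum// => k _; rewrite nrm_scale nrmX exprMn mulrCA.
      by rewrite ler_wpM2l// exprn_ge0// ltW.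
    by rewrite -mulr_sumr ler_wpM2l// sum_geometric_tail.
  move: key; rewrite subr0 nrm_scale nrmX -/t => key.
  have inv2 : (1 - t / r)^-1 <= 2 by rewrite -[2]invrK lef_pV2 ?posrE; lra.
  have : nrm (a n) <= D * t.
    rewrite -(ler_pM2l (exprn_gt0 n zp)) (le_trans key)// /D.
    have -> : t ^+ n * (2 * B * r^-1 ^+ n.+1 * t) = B * ((t / r) ^+ n.+1 * 2).
      by rewrite exprMn [t ^+ n.+1]exprS; ring.
    by rewrite ler_wpM2l// ler_wpM2l// exprn_ge0.
  move=> /le_trans; apply.
  apply: (@le_trans _ _ (D * (e / (D + 1)))); first by rewrite ler_wpM2l// ltW.
  by rewrite mulrCA ler_piMr ?(ltW ee0)// ler_pdivrMr ?mul1r ?lerDl// ltr_wpDl.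
apply/nbhs_nrmP; exists e0 => // z /fE/cvg_seq_unique; apply.
rewrite (_ : series _ = fun=> 0); first exact: cvg_cst.
by apply/funext => n; rewrite /series /= big1// => k _; rewrite a0 scaler0.
Qed.

(** The interior of the zero set is open by definition, and closed in [U] because
its limit points are limits of zeros. Connectedness of [U] concludes. *)
Lemma analytic_identity (U : set R[i]^o) (f : R[i]^o -> Y) (z0 : R[i]^o) :
  connected U -> analytic_on U f -> U z0 -> (\forall z \near z0, f z = 0) ->
  forall z, U z -> f z = 0.
Proof.
move=> Uc fan Uz0 f0.
pose V := [set z : R[i]^o | \forall w \near z, f w = 0].
have Vo : open V by exact: (open_interior [set z | f z = 0]).
have : U `&` V = U.
  apply: Uc; first by exists z0.
    by exists V.
  exists (closure V); first exact: closed_closure.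
  apply/seteqP; split=> [z [Uz Vz]|z [Uz Vz]]; first by split=> //; exact: subset_closure.
  split=> //; apply: contrapT => nVz; apply: nVz.
  have [//|nVz] := pselect (V z).
  have [a fa] := fan z Uz.
  apply: (power_series_zeros fa) => e e0.
  have [y Vy zy] := (closure_nrmP V z).1 Vz e e0.
  exists y; split; last by exact: nbhs_singleton Vy.
    rewrite lt_neqAle nrm_ge0 andbT eq_sym; apply/eqP => /nrm_eq0/eqP.
    by rewrite subr_eq0 => /eqP yz; apply: nVz; rewrite -yz.
  by rewrite nrmB.
move=> UV z; rewrite -UV => -[_ Vz]; exact: nbhs_singleton Vz.
Qed.

End PowerSeries.

(** * Power series are analytic in their disc of convergence *)

Section Reexpansion.
Context {R : realType} {Y : completeNormedModType R[i]}.
Implicit Types (a : nat -> Y) (z w : R[i]).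

(** The coefficient of [w ^+ k] in [(z + w) ^+ n]. *)
Definition taylor_coef z n k : R[i] := z ^+ (n - k) *+ 'C(n, k).

Lemma taylor_coefE z w n K : (n < K)%N ->
  (z + w) ^+ n = \sum_(0 <= k < K) w ^+ k * taylor_coef z n k.
Proof.
move=> nK; rewrite (@big_cat_nat _ _ _ n.+1)//=.
rewrite [X in _ = _ + X]big_nat [X in _ = _ + X]big1 ?addr0.
  by rewrite exprDn big_mkord; apply: eq_bigr => k _; rewrite /taylor_coef mulrnAr mulrC.
by move=> k /andP[nk _]; rewrite /taylor_coef bin_small// mulr0n mulr0.
Qed.

Lemma nrm_taylor_coef z n k : 
  nrm (taylor_coef z n k : R[i]^o) = nrm (z : R[i]^o) ^+ (n - k) *+ 'C(n, k).
Proof. by rewrite /taylor_coef (@nrm_mulrn _ R[i]^o) nrmX. Qed.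

Lemma sum_nrm_taylor_coef z (h : R) n K : 0 <= h ->
  \sum_(0 <= k < K) h ^+ k * nrm (taylor_coef z n k : R[i]^o) <=
  (nrm (z : R[i]^o) + h) ^+ n.
Proof.
move=> h0; have term0 k : 0 <= h ^+ k * nrm (taylor_coef z n k : R[i]^o).
  by rewrite mulr_ge0 ?exprn_ge0 ?nrm_ge0.
apply: (@le_trans _ _
  (\sum_(0 <= k < K + n.+1) h ^+ k * nrm (taylor_coef z n k : R[i]^o))).
  rewrite (@big_cat_nat _ _ _ K _ (K + n.+1))//= ?leq_addr// lerDl.
  by rewrite sumr_ge0.
rewrite (@big_cat_nat _ _ _ n.+1)//= ?leq_addl//.
rewrite [X in _ + X <= _]big_nat [X in _ + X <= _]big1 ?addr0.
  rewrite exprDn big_mkord ler_sum// => k _.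
  by rewrite nrm_taylor_coef mulrnAr mulrC.
by move=> k /andP[nk _]; rewrite nrm_taylor_coef bin_small// mulr0n mulr0.
Qed.

(** Truncating the binomial expansion leaves some of its terms, whose norms add up
to at most the expansion at the norms of [z] and [w]. *)
Lemma nrm_taylor_remainder z w n K :
  nrm ((z + w) ^+ n - \sum_(0 <= k < K) w ^+ k * taylor_coef z n k : R[i]^o) <=
  if (n < K)%N then 0 else (nrm (z : R[i]^o) + nrm (w : R[i]^o)) ^+ n.
Proof.
case: ltnP => nK; first by rewrite (taylor_coefE _ _ nK) subrr nrm0.
rewrite (taylor_coefE z w (ltnSn n)) (@big_cat_nat _ _ _ K)//= ?leqW//.
rewrite addrAC subrr add0r (le_trans (@nrm_sum_nat _ R[i]^o _ _ _))//.
apply: le_trans (sum_nrm_taylor_coef z n n.+1 (nrm_ge0 (w : R[i]^o))).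
rewrite [X in _ <= X](@big_cat_nat _ _ _ K)//= ?leqW//.
under eq_bigr do rewrite nrmM nrmX.
by rewrite lerDr sumr_ge0// => k _; rewrite mulr_ge0 ?exprn_ge0 ?nrm_ge0.
Qed.

(** Analyticity at a point [z0] other than the centre: the coefficients are the
sums [A k] of the series of the [taylor_coef z0 n k *: a n]. The error of the
[K]-th partial sum is the series of the [a n] weighted by the remainders of
the binomial expansions; these vanish for [n < K], and the others are bounded
by [r ^+ n] with [r = nrm z0 + nrm (z - z0)], so the error is a tail of a geometric series of ratio [r * c]. *)
Lemma power_series_analytic a (B c : R) : 0 < c -> (forall n, nrm (a n) <= B * c ^+ n) ->
  exists2 f : R[i]^o -> Y,
    forall z : R[i]^o, nrm z < c^-1 -> series (fun n => z ^+ n *: a n) @ \oo --> f z &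
    analytic_on [set z : R[i]^o | nrm z < c^-1] f.
Proof.
move=> c0 aB.
have B0 : 0 <= B.
  by have := aB 0%N; rewrite expr0 mulr1; apply/le_trans/nrm_ge0.
have H (z : R[i]^o) : exists y : Y,
    nrm z < c^-1 -> series (fun n => z ^+ n *: a n) @ \oo --> y.
  have [zc|] := ltP (nrm z) c^-1; last by exists 0.
  have [|||y sy _] := @geometric_series_cvg _ _ (fun n => z ^+ n *: a n) B (nrm z * c).
  - by rewrite mulr_ge0 ?nrm_ge0// ltW.
  - by rewrite -ltr_pdivlMr// div1r.
  - by move=> n; rewrite nrm_scale nrmX exprMn mulrCA ler_wpM2l ?exprn_ge0 ?nrm_ge0.
  by exists y.
have [f fP] := choice H.
exists f => // z0 /= z0c.
have [h h0 hc] : exists2 h : R, 0 < h & nrm z0 + h < c^-1.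
  exists ((c^-1 - nrm z0) / 2); first by rewrite divr_gt0// subr_gt0.
  by move: z0c; lra.
have q0 (t : R) : 0 <= t -> 0 <= t * c by move=> t0; rewrite mulr_ge0// ltW.
have q1 (t : R) : t < c^-1 -> t * c < 1 by move=> tc; rewrite -ltr_pdivlMr// div1r.
have zh0 : 0 <= nrm z0 + h by rewrite addr_ge0 ?nrm_ge0// ltW.
have HA k : exists y : Y, series (fun n => taylor_coef z0 n k *: a n) @ \oo --> y.
  have [|||y sy _] := @geometric_series_cvg _ _ (fun n => taylor_coef z0 n k *: a n)
     (B / h ^+ k) ((nrm z0 + h) * c).
  - exact: q0.
  - exact: q1.
  - move=> n; rewrite nrm_scale exprMn.
    have tk : nrm (taylor_coef z0 n k : R[i]^o) <= (nrm z0 + h) ^+ n / h ^+ k.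
      rewrite ler_pdivlMr ?exprn_gt0// mulrC.
      apply: le_trans (sum_nrm_taylor_coef z0 n k.+1 (ltW h0)).
      rewrite big_nat_recr//= lerDr sumr_ge0// => j _.
      by rewrite mulr_ge0 ?exprn_ge0 ?nrm_ge0// ltW.
    have -> : B / h ^+ k * ((nrm z0 + h) ^+ n * c ^+ n) =
      ((nrm z0 + h) ^+ n / h ^+ k) * (B * c ^+ n) by ring.
    by rewrite ler_pM ?nrm_ge0.
  by exists y.
have [A AP] := choice HA.
exists A; apply/nbhs_nrmP; exists h => // z; rewrite nrmB => zh.
pose w := z - z0; have zE : z0 + w = z by rewrite addrC subrK.
pose r := nrm z0 + nrm w.
have r0 : 0 <= r by rewrite addr_ge0 ?nrm_ge0.
have rc : r < c^-1 by apply: lt_trans hc; rewrite ltrD2l.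
have zc : nrm z < c^-1 by rewrite -zE (le_lt_trans (nrmD _ _)).
apply: (@cvg_nrm_le _ _ _ _ (fun K => B * ((r * c) ^+ K / (1 - r * c)))); last first.
  by apply: cvg_geometric_bound; [exact: q0|exact: q1].
move=> K.
pose S N : Y := \sum_(0 <= k < K) w ^+ k *: series (fun n => taylor_coef z0 n k *: a n) N.
have Scvg : S @ \oo --> series (fun k => w ^+ k *: A k) K.
  rewrite /S /series /=; elim: (K) => [|j IH].
    rewrite big_geq//; under eq_fun do rewrite big_geq//.
    exact: cvg_cst.
  rewrite big_nat_recr//=; under eq_fun do rewrite big_nat_recr//=.
  apply: cvgD => //; apply: cvgZl_tmp; exact: AP.
rewrite nrmB.
have Dcvg : (fun N => S N - series (fun n => z ^+ n *: a n) N) @ \oo -->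
    series (fun k => w ^+ k *: A k) K - f z.
  by apply: cvgB => //; exact: fP.
rewrite -[X in nrm X]subr0 nrmB.
apply: (nrm_cvg_le Dcvg); apply: nearW => N; rewrite sub0r nrmN nrmB.
have -> : series (fun n => z ^+ n *: a n) N - S N =
  \sum_(0 <= n < N) (z ^+ n - \sum_(0 <= k < K) w ^+ k * taylor_coef z0 n k) *: a n.
  rewrite /S /series /=; under [in X in _ - X]eq_bigr do rewrite scaler_sumr.
  rewrite exchange_big /= -sumrB; apply: eq_bigr => n _.
  rewrite scalerBl scaler_suml; congr (_ - _); apply: eq_bigr => k _.
  by rewrite scalerA.
rewrite (le_trans (nrm_sum_nat _ _ _))//.
apply: (@le_trans _ _ (\sum_(0 <= n < N) if (n < K)%N then 0 else B * (r * c) ^+ n)).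
  rewrite ler_sum// => n _; rewrite nrm_scale.
  have := nrm_taylor_remainder z0 w n K; rewrite zE; case: ifP => _ rem.
    by rewrite (le_trans (ler_wpM2r (nrm_ge0 _) rem))// mul0r.
  rewrite (le_trans (ler_pM (nrm_ge0 _) (nrm_ge0 _) rem (aB n)))//.
  by rewrite exprMn mulrCA.
have [NK|KN] := leqP N K.
  rewrite big_nat big1 => [|n /andP[_ nN]]; last by rewrite (leq_trans nN NK).
  rewrite mulr_ge0// divr_ge0 ?exprn_ge0 ?q0//.
  by rewrite subr_ge0 ltW// q1.
rewrite (@big_cat_nat _ _ _ K)//= ?(ltnW KN)//.
rewrite big_nat big1 ?add0r => [|n /andP[_ ->]//].
rewrite big_nat; under eq_bigr => n /andP[Kn _] do rewrite ltnNge Kn /=.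
by rewrite -big_nat -mulr_sumr ler_wpM2l// sum_geometric_tail ?q0 ?q1// ltnW.
Qed.

End Reexpansion.

(** * Single-valued extension property of the adjoint *)

Section AdjointChains.
Context {R : realType} {X : completeNormedModType R[i]} (T : bop X X).
Variables (M N : closed_subspace X).
Hypotheses (TM : Defs.invariant T M) (TN : Defs.invariant T N) (MN : direct_sum M N).

Lemma adjointE (f : dual_space X) x : adjoint T f x = f (T x).
Proof. by []. Qed.

Lemma adjoint_eq (f g : dual_space X) :
  (forall m, cs_set M m -> g (T m) = f m) -> (forall n, cs_set N n -> g (T n) = f n) ->
  adjoint T g = f.
Proof.
move=> gM gN; apply/val_inj/funext => x /=.
have [m [n [Mm Nn ->]]] := direct_sum_decomp x MN.1.
by rewrite !linearD/= gM// gN.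
Qed.

(** A function [f] as in the definition of the property takes its values at [l] in
the kernel of [l - T'], where [T'] is the adjoint, so [l ^ k f(l)] is [f(l)] composed with [T ^ k]. For
[l] nonzero, [f(l)] vanishes on [N] because [T] is quasinilpotent there; for
[l] small, it vanishes on [M] because every point of [M] has a backward orbit
of uniformly bounded growth. The identity theorem carries this to all of the
domain. *)
Lemma surj_SVEP : T @` M = M -> quasinilpotent_on T N -> SVEP_at (adjoint T) 0.
Proof.
move=> TME Nq U Uo Uc U0 f fan fT.
have fE l x : U l -> l * f l x = f l (T x).
  by move=> /(fT l)/subr0_eq lf; rewrite -adjointE -lf bop_scaleE.
have [C C0 CP] := backward_orbits TME.
have f0 l : U l -> l != 0 -> nrm (l : R[i]^o) < C^-1 -> f l = 0.
  move=> Ul l0 lC; apply/val_inj/funext => x /=.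
  have lp : 0 < nrm (l : R[i]^o).
    rewrite lt_neqAle nrm_ge0 andbT eq_sym; apply/eqP => /(@nrm_eq0 _ R[i]^o) lz.
    by rewrite lz eqxx in l0.
  have fIE k y : l ^+ k * f l y = f l (iter k T y).
    elim: k y => [|k IH] y; first by rewrite expr0 mul1r.
    by rewrite iterSr -IH -fE// exprSr mulrA.
  have fN n : cs_set N n -> f l n = 0.
    move=> Nn; apply: (@nrm_eq0 _ R[i]^o); apply/eqP; rewrite eq_le nrm_ge0 andbT.
    have [|D D0 DP] := Nq (nrm (l : R[i]^o) / 2); first by rewrite divr_gt0.
    apply: (@le_geometric_le0 _ _ (opnorm (f l) * D * nrm n) 2^-1); rewrite ?invr_ge0//.
      by rewrite invf_lt1// ltr1n.
    move=> k; rewrite -(ler_pM2l (exprn_gt0 k lp)) -nrmX -nrmM fIE.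
    rewrite (le_trans (nrm_le_opnorm _ _))//.
    rewrite (le_trans (ler_wpM2l (opnorm_ge0 _) (DP k n Nn)))// exprMn nrmX.
    by rewrite le_eqVlt; apply/orP; left; apply/eqP; ring.
  have fM m : cs_set M m -> f l m = 0.
    move=> /CP[u [u0 uS uC]]; apply: (@nrm_eq0 _ R[i]^o); apply/eqP.
    rewrite eq_le nrm_ge0 andbT.
    apply: (@le_geometric_le0 _ _ (opnorm (f l) * nrm m) (nrm (l : R[i]^o) * C)).
    - by rewrite mulr_ge0 ?nrm_ge0// ltW.
    - by rewrite -ltr_pdivlMr// div1r.
    - move=> k; have uE : iter k T (u k) = m.
        by elim: k => // k IH; rewrite iterSr uS.
      rewrite -{1}uE -fIE nrmM nrmX exprMn mulrCA ler_wpM2l ?exprn_ge0 ?nrm_ge0//.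
      by rewrite (le_trans (nrm_le_opnorm _ _))// -mulrA ler_wpM2l ?opnorm_ge0.
  have [m [n [Mm Nn ->]]] := direct_sum_decomp x MN.1.
  by rewrite linearD/= fM// fN// addr0.
apply: (analytic_identity Uc fan U0).
have [a fa] := fan 0 U0.
apply: (power_series_zeros fa) => e e0.
have [d d0 dU] : exists2 d : R, 0 < d & forall y : R[i]^o, nrm y < d -> U y.
  have /nbhs_nrmP[d d0 dU] : nbhs (0 : R[i]^o) U by exact: open_nbhs_nbhs.
  by exists d => // y yd; apply: dU; rewrite sub0r nrmN.
pose t := Num.min (e / 2) (Num.min (d / 2) (C^-1 / 2)).
have t0 : 0 < t by rewrite !lt_min !divr_gt0// invr_gt0.
have half_lt (u : R) : 0 < u -> u / 2 < u.
  by move=> u0; rewrite ltr_pdivrMr// ltr_pMr// ltr1n.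
exists (t%:C : R[i]^o); rewrite subr0 nrmC gtr0_norm//; split=> //.
  by rewrite /t gt_min half_lt.
apply: f0.
- by apply: dU; rewrite nrmC gtr0_norm// /t !gt_min half_lt// orbT.
- by rewrite fmorph_eq0 gt_eqF.
- by rewrite nrmC gtr0_norm// /t !gt_min (half_lt C^-1) ?invr_gt0// !orbT.
Qed.

Hypotheses (Wcl : closed (T @` M)) (Wnull : hereditary_null T M).

(** The functionals that can be lifted through the adjoint indefinitely: vanishing on
the null space of [T] in [M] allows one lift, and vanishing on those of all
powers of [T] is inherited by the lift. *)
Definition annihilator_of_nulls (f : dual_space X) :=
  (forall n, cs_set N n -> f n = 0) /\
  (forall k m, cs_set M m -> iter k T m = 0 -> f m = 0).

(** The lift [g] is prescribed by [g (T m + n) = f m], which is well posed and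
bounded since [f] vanishes on the null space of [T] in [M] and preimages under
[T] can be chosen with a bound; it is then extended by Hahn-Banach. *)
Lemma adjoint_lift : exists2 C : R, 0 < C & forall f, annihilator_of_nulls f ->
  exists g, [/\ annihilator_of_nulls g, adjoint T g = f & nrm g <= C * nrm f].
Proof.
have [D D0 DP] := closed_range_lift Wcl.
have [P P0 PP] := direct_sum_bounded_projection MN.
exists (D * P) => [|f [fN fM]]; first by rewrite mulr_gt0.
have DPf : 0 <= D * P * opnorm f by rewrite mulr_ge0 ?opnorm_ge0// ltW// mulr_gt0.
have TMm m : cs_set M m -> cs_set M (T m) by move=> Mm; apply: TM; exists m.
have [|k x y c d|x c|g gG gC] := @hahn_banach_graph R X
  (fun x c => exists m n, [/\ cs_set M m, cs_set N n, x = T m + n & c = f m])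
  (D * P * opnorm f) DPf.
- by exists 0, 0; rewrite !linear0 addr0; split=> //; exact: cs0.
- move=> [m [n [Mm Nn -> ->]]] [m' [n' [Mm' Nn' -> ->]]].
  exists (k *: m + m'), (k *: n + n'); split.
  + by apply: csD => //; exact: csZ.
  + by apply: csD => //; exact: csZ.
  + by rewrite bop_linear scalerDr addrACA.
  + by rewrite bop_linear.
- move=> [m [n [Mm Nn -> ->]]].
  have [y [My Ty yD]] := DP m Mm.
  have -> : f m = f y.
    apply/eqP; rewrite -subr_eq0 -bopB (fM 1%N) ?eqxx//; first exact: csB.
    by rewrite /= bopB Ty subrr.
  rewrite (le_trans (nrm_le_opnorm f y))// [D * P * _]mulrC -!mulrA.
  rewrite ler_wpM2l ?opnorm_ge0// (le_trans yD)// ler_pM2l//.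
  by apply: PP => //; exact: TMm.
have gN n : cs_set N n -> g n = 0.
  move=> Nn; rewrite (gG n (f 0)) ?linear0//; exists 0, n.
  by rewrite !linear0 add0r; split=> //; exact: cs0.
have gT m : cs_set M m -> g (T m) = f m.
  by move=> Mm; apply: gG; exists m, 0; rewrite addr0; split=> //; exact: cs0.
exists g; split.
- split=> // k m Mm Tkm; have [y My ym] := Wnull Mm Tkm.
  by rewrite -ym gT// (fM k.+1)// iterSr ym.
- apply: adjoint_eq => // n Nn.
  by rewrite fN// gN//; apply: TN; exists n.
- exact: (@opnorm_le _ _ _ g).
Qed.

(** The distance of [x0] to the closed set [T @` M] is positive, so Hahn-Banach
gives a functional with value [1] at [x0] that vanishes on [T @` M] and on [N].
The null spaces are inside [T @` M]. *)
Lemma exists_annihilator x0 : cs_set M x0 -> ~ (T @` M) x0 ->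
  exists f, [/\ annihilator_of_nulls f, adjoint T f = 0 & f <> 0].
Proof.
move=> Mx0 Wx0.
have [P P0 PP] := direct_sum_bounded_projection MN.
have W0 : (T @` M) 0 by exists 0; rewrite ?linear0//; exact: cs0.
have WDZ k x y : (T @` M) x -> (T @` M) y -> (T @` M) (k *: x + y).
  move=> [x' Mx' <-] [y' My' <-]; exists (k *: x' + y'); last exact: bop_linear.
  by apply: csD => //; exact: csZ.
have WM w : (T @` M) w -> cs_set M w by exact: TM.
have [d d0 dW] : exists2 d : R, 0 < d & forall w, (T @` M) w -> d <= nrm (x0 - w).
  apply: contrapT => H; apply: Wx0; apply/(closed_nrmP (T @` M)).1 => // e e0.
  apply: contrapT => G; apply: H; exists e => // w Ww.
  by rewrite leNgt; apply/negP => xw; apply: G; exists w.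
have [||k x y c1 c2|x c|f fG fC] := @hahn_banach_graph R X
  (fun x c => exists w n, [/\ (T @` M) w, cs_set N n & x = w + n + c *: x0])
  (P / d).
- by rewrite divr_ge0// ltW.
- by exists 0, 0; rewrite scale0r !addr0; split=> //; exact: cs0.
- move=> [w [n [Ww Nn ->]]] [w' [n' [Ww' Nn' ->]]].
  exists (k *: w + w'), (k *: n + n'); split.
  + exact: WDZ.
  + by apply: csD => //; exact: csZ.
  + rewrite !scalerDr scalerDl scalerA addrACA; congr (_ + _).
    by rewrite addrACA.
- move=> [w [n [Ww Nn ->]]].
  have [->|c0] := eqVneq c 0.
    by rewrite (@nrm0 _ R[i]^o) mulr_ge0 ?nrm_ge0// divr_ge0// ltW.
  have -> : w + n + c *: x0 = (w + c *: x0) + n by rewrite addrAC.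
  have Mw : cs_set M (w + c *: x0) by apply: csD; [exact: WM|exact: csZ].
  rewrite mulrAC ler_pdivlMr//; apply: le_trans (PP _ _ Mw Nn).
  have -> : w + c *: x0 = c *: (x0 - (- c^-1 *: w + 0)).
    by rewrite addr0 scaleNr opprK scalerDr scalerA mulfV// scale1r addrC.
  by rewrite nrm_scale ler_wpM2l ?nrm_ge0// dW//; exact: WDZ.
have fN n : cs_set N n -> f n = 0.
  by move=> Nn; apply: fG; exists 0, n; rewrite add0r scale0r addr0.
have fW w : (T @` M) w -> f w = 0.
  by move=> Ww; apply: fG; exists w, 0; rewrite scale0r !addr0; split=> //; exact: cs0.
exists f; split.
- by split=> // k m Mm Tkm; apply: fW; exact: Wnull Mm Tkm.
- apply: adjoint_eq => [m Mm|n Nn]; first by rewrite fW//; exists m.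
  by rewrite fN//; apply: TN; exists n.
- move=> f0; have : f x0 = 1.
    by apply: fG; exists 0, 0; rewrite scale1r !add0r; split=> //; exact: cs0.
  by rewrite f0 => /eqP; rewrite eq_sym oner_eq0.
Qed.

(** If [T @` M] is a proper subspace of [M], a nonzero functional [f0] killed by
the adjoint [T'] starts a sequence with [T' (fs n.+1) = fs n] and geometric growth. The
sum of the [l ^ n fs n] is analytic on a disc, is killed by [l - T'], and is
[f0] at [0]: the single-valued extension property fails. *)
Lemma SVEP_surj : SVEP_at (adjoint T) 0 -> T @` M = M.
Proof.
move=> sv; apply/seteqP; split; first exact: TM.
move=> x0 Mx0; apply: contrapT => Wx0.
have [f0 [f0A Tf0 f00]] := exists_annihilator Mx0 Wx0.
have [C C0 CP] := adjoint_lift.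
have H f : exists g, annihilator_of_nulls f ->
    [/\ annihilator_of_nulls g, adjoint T g = f & nrm g <= C * nrm f].
  have [/CP[g gP]|] := pselect (annihilator_of_nulls f); last by exists 0.
  by exists g.
have [F FP] := choice H.
pose fs n := iter n F f0.
have fsA n : annihilator_of_nulls (fs n) by elim: n => //= n /FP[].
have fsC n : nrm (fs n) <= nrm f0 * C ^+ n.
  elim: n => [|n IH]; first by rewrite expr0 mulr1.
  have [_ _ /le_trans] := FP _ (fsA n); apply.
  by rewrite exprS mulrCA ler_pM2l.
have fsT n : adjoint T (fs n.+1) = fs n by have [] := FP _ (fsA n).
have [f fE fan] := power_series_analytic C0 fsC.
pose U := [set z : R[i]^o | nrm z < C^-1].
have Uo : open U.
  rewrite openE => z Uz; apply/nbhs_nrmP.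
  exists (C^-1 - nrm z); first by rewrite subr_gt0.
  move=> y zy; rewrite /U /= -[y](subKr z) (le_lt_trans (nrmD _ _))// nrmN.
  by rewrite -ltrBrDl.
have U0 : U 0 by rewrite /U /= nrm0 invr_gt0.
have fT l : U l -> l *: f l - adjoint T (f l) = 0.
  move=> Ul; apply/eqP; rewrite subr_eq0; apply/eqP.
  set s := series (fun n => l ^+ n *: fs n).
  have sT n : adjoint T (s n.+1) = l *: s n.
    elim: n => [|n IH].
      by rewrite /s seriesSr !series0 add0r expr0 scale1r scaler0 Tf0.
    rewrite [in LHS]/s seriesSr -/s bopD IH bopZ fsT.
    by rewrite /s seriesSr scalerDr scalerA -exprS.
  apply: (cvg_seq_unique (u := fun n => l *: s n)).
    by apply: cvgZl_tmp; exact: fE.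
  rewrite (_ : (fun n => _) = fun n => adjoint T (s n.+1)); last exact/funext.
  apply: (bop_cvg (adjoint T)); rewrite (cvg_shiftS s); exact: fE.
have := sv U Uo (@connected_disc R _) U0 f fan fT 0 U0.
suff -> : f 0 = f0 by [].
apply: (cvg_seq_unique (fE 0 U0)); rewrite -(cvg_shiftS _).
rewrite (_ : (fun n => _) = fun=> f0); first exact: cvg_cst.
apply/funext; elim => [|n IH].
  by rewrite seriesSr series0 add0r expr0 scale1r.
by rewrite seriesSr IH expr0n scale0r addr0.
Qed.

End AdjointChains.

(** * Right generalized Drazin invertibility *)

Section RightGeneralizedDrazin.
Context {R : realType} {X : completeNormedModType R[i]} (T : bop X X).

Lemma GKD_equivalences (M N : closed_subspace X)
    (MN : generalized_Kato_decomposition T M N) :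
  [<-> SVEP_at (adjoint T) 0;
       set_surj setT setT (restriction (GKD_invl MN));
       analytical_core T = M;
       set_sum (analytical_core T) (quasinilpotent_part T) = setT;
       dense (set_sum (analytical_core T) (quasinilpotent_part T))].
Proof.
have [MNs TM TN TMsr TNq] := MN.
have [Wcl Wnull] := (restriction_semi_regularP TM).1 TMsr.
have Nq := (quasinilpotent_restrictionP TN).1 TNq.
have NH := quasinilpotent_on_sub Nq.
have surjE := restriction_surjP (GKD_invl MN).
tfae.
- move=> sv; apply/surjE; exact: (SVEP_surj TM TN MNs Wcl Wnull sv).
- move=> surj; have TME := surjE.1 surj.
  apply/seteqP; split; last exact: sub_analytical_core.
  exact: (analytical_core_sub TM TN MNs Nq).
- move=> ->; apply/seteqP; split=> // x _.
  have [m [n [Mm Nn ->]]] := direct_sum_decomp x MNs.1.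
  by exists m => //; exists n => //; exact: NH.
- by move=> -> O [x Ox] _; exists x.
- move=> /(dense_core_surj TM Wcl Wnull TN MNs Nq) TME.
  exact: (surj_SVEP MNs TME Nq).
Qed.

(** Here [M] is the core itself. As [T] maps the core onto itself, the restriction
is semi-regular for trivial reasons. *)
Lemma right_gen_Drazin_GKD : right_gen_Drazin_invertible T ->
  exists (M N : closed_subspace X) (MN : generalized_Kato_decomposition T M N),
    analytical_core T = M.
Proof.
move=> [Kcl [N [KN TN NH]]].
have Ksub : submod_closed (mem (analytical_core T)).
  split; first exact/mem_set/analytical_core0.
  by move=> k x y /set_mem Kx /set_mem Ky; exact/mem_set/analytical_coreDZ.
pose M := ClosedSubspace Ksub Kcl.
have TM : Defs.invariant T M by move=> _ [x Kx <-]; exact: analytical_core_image.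
have TME : T @` M = M.
  apply/seteqP; split=> // x /analytical_core_preimage[y Ky yx].
  by exists y.
suff MN : generalized_Kato_decomposition T M N by exists M, N, MN.
apply: (@GeneralizedKatoDecomposition _ _ T M N KN TM TN).
  by apply/restriction_semi_regularP; rewrite /hereditary_null TME; split.
by apply/quasinilpotent_restrictionP; exact: sub_quasinilpotent_on.
Qed.

End RightGeneralizedDrazin.

Theorem theorem3p4 (R : realType) (X : completeNormedModType R[i])
    (T : bop X X) (X_infinite : ~ finite_dimensional X) :
  (right_gen_Drazin_invertible T <->
   exists (M N : closed_subspace X)
          (MN : generalized_Kato_decomposition T M N),
     SVEP_at (adjoint T) 0 \/
     set_surj setT setT (restriction (GKD_invl MN)) \/
     analytical_core T = M \/
     set_sum (analytical_core T) (quasinilpotent_part T) = setT \/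
     dense (set_sum (analytical_core T) (quasinilpotent_part T))) /\
  (forall (M N : closed_subspace X)
          (MN : generalized_Kato_decomposition T M N),
     [<-> SVEP_at (adjoint T) 0;
          set_surj setT setT (restriction (GKD_invl MN));
          analytical_core T = M;
          set_sum (analytical_core T) (quasinilpotent_part T) = setT;
          dense (set_sum (analytical_core T) (quasinilpotent_part T))]).
Proof.
split; last exact: GKD_equivalences.
split=> [/right_gen_Drazin_GKD[M [N [MN KM]]]|[M [N [MN]]]].
  by exists M, N, MN; right; right; left.
have E := GKD_equivalences MN.
have KM_Drazin : analytical_core T = M -> right_gen_Drazin_invertible T.
  move=> KM; rewrite /right_gen_Drazin_invertible KM; split; first exact: cs_closed.
  have [MNs _ TN _ TNq] := MN; exists N; split=> //.
  exact/quasinilpotent_on_sub/(quasinilpotent_restrictionP TN).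
by case=> [/(E 0 2)|[/(E 1 2)|[//|[/(E 3 2)|/(E 4 2)]]]].
Qed.
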